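(* Consider the setting described in the context and fix $\bar n\in\mathbb{N}$. Suppose that the problem $$\text{minimize}_{\hat z\in\hat A,\ \gamma\in\mathbb{R},\ \sigma\ge0}\ \hat f(\hat z)+\mathbb{E}\big[\hat g_1(s(\boldsymbol{\xi},\hat z),\hat z)\big]\ \text{ subject to }\ \mathbb{E}\Big[\sigma+\gamma+\tfrac1{1-\alpha}\max\{0,\hat g_2(s(\boldsymbol{\xi},\hat z),\hat z)-\gamma\}\Big]=0$$ has a finite minimum value $\tau$ (that is, $\inf\phi=\tau\in\mathbb{R}$), $A$ is closed, $f$ is continuous relative to $A$, the random elements $\boldsymbol{\xi}_1,\boldsymbol{\xi}_2,\dots$ are independent and identically distributed as $\boldsymbol{\xi}$, and that: (B$_Z$) For each $\bar z\in A$, $G(\cdot,\bar z)$ is measurable and there are $\rho\in(0,\infty)$ and a $P$-integrable $c:\Xi\to[0,\infty)$ such that $\|G(\xi,z)\|_\infty\le c(\xi)$ for all $z\in A$ with $\|z-\bar z\|_Z\le\rho$ and a.e. $\xi\in\Xi$. (Q) For all $z\in A$ with $\psi(z)=0$, there exists $z^n\in A\cap Z^n$ with $z^n\to z$ as $n\to\infty$ such that $\psi(z^n)<0$ for $n\in\mathbb{N}$. Suppose that, for all $n\ge\bar n$, $\inf\phi_n<\infty$ and the following four conditions hold: 1. For a.e. $\xi\in\Xi$ and $i=1,2$, the mappings $s(\xi,\cdot):Z\to U$, $g_i:U\times Z\to\mathbb{R}$ and $T_n$ are continuous; and for every $z_n\in\mathbb{R}^{n}\times\mathbb{R}^2$,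 $G_n(\cdot,z_n):\Xi\to\mathbb{R}^2$ is measurable. 2. For each $\bar z_n\in A_n$ there are $\rho\in(0,\infty)$ and a $P$-integrable $c:\Xi\to[0,\infty)$ such that $\|G_n(\xi,z_n)\|_\infty\le c(\xi)$ for all $z_n\in\mathbb{B}(\bar z_n,\rho)\cap A_n$ and a.e. $\xi\in\Xi$. 3. There exist $\eta,\kappa\in(0,\infty)$, $\lambda,\mu:\Xi\to[0,\infty)$, $\rho,\pi:A_n\to(0,\infty)$ and $\Delta_0,\Delta_\nu:A_n\to[0,\infty)$, $\nu\in\mathbb{N}$, such that: (i) $\mathbb{E}[\lambda^\eta(\boldsymbol{\xi})\mu^\kappa(\boldsymbol{\xi})]$ and $\mathbb{E}[\mu^\kappa(\boldsymbol{\xi})]$ are finite; (ii) for all $z_n\in A_n$, $z^n=T_n(z_n)$, $u,u'\in U$, $\nu\in\mathbb{N}$, $i=1,2$, and a.e. $\xi\in\Xi$, one has $$|g_i(u,z^n)-g_i(u',z^n)|\le\pi(z_n)\big(\|u\|_U^\eta+\|u'\|_U^\eta+1\big)\|u-u'\|_U^\kappa,$$ $$\max\{\|s(\xi,z^n)\|_U,\|s^\nu(\xi,z^n)\|_U\}\le\lambda(\xi)\Delta_0(z_n),\qquad \|s^\nu(\xi,z^n)-s(\xi,z^n)\|_U\le\mu(\xi)\Delta_\nu(z_n);$$ (iii) for all $\bar z_n\in A_n$, with $B=\mathbb{B}(\bar z_n,\rho(\bar z_n))\cap A_n$, one has $\sup_{z_n\in B}\pi(z_n)<\infty$, $\sup_{z_n\in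 B}\Delta_0(z_n)<\infty$, and $\sup_{z_n\in B}\Delta_\nu(z_n)\to0$ as $\nu\to\infty$. 4. For all $z_n\in A_n$ with $\psi(T_n(z_n))=0$, there exists $z_n^\nu\in A_n$ with $z_n^\nu\to z_n$ as $\nu\to\infty$ such that $\psi(T_n(z_n^\nu))<0$ for all $\nu\in\mathbb{N}$. Moreover, let $\{y^\nu,\nu\in\mathbb{N}\}\subset\mathbb{R}$ be bounded, $\theta^\nu\in(0,\infty)$ with $\theta^\nu\to\infty$, and $\beta^\nu\in(0,\infty)$ with $\beta^\nu\to0$. Then, with probability one (over the sample defining the functions $\phi_n^\nu$), the following holds: for any $\epsilon\in(0,\infty)$ there exists $n_\epsilon\ge\bar n$ such that if $n\ge n_\epsilon$, $\delta^\nu\in[0,\infty)$ with $\delta^\nu\to\delta\in[0,\infty)$, and $\{\bar z_n^\nu\in\delta^\nu\text{-}\operatorname{argmin}\phi_n^\nu,\ \nu\in\mathbb{N}\}$ has a cluster point $\bar z_n$, then $\bar z=T_n(\bar z_n)\in A$ and $$f(\bar z)+\mathbb{E}\big[\hat g_1(s(\boldsymbol{\xi},\bar z),\bar z)\big]\le\tau+\epsilon+\delta,\qquad \text{b-prob}\big\{\hat g_2(s(\boldsymbol{\xi},\bar z),\bar z)>0\big\}\le1-\alpha .$$ That is, (the $\hat Z$-component of) $\bar z$ is feasible, with optimality gap $\epsilon+\delta$, in the problem of minimizing $\hat f(\hat z)+\mathbb{E}[\hat g_1(s(\boldsymbol{\xi},\hat z),\hat z)]$ over $\hat z\in\hat A$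 subject to $\text{b-prob}\{\hat g_2(s(\boldsymbol{\xi},\hat z),\hat z)>0\}\le1-\alpha$.
   Context: Setting. $(\hat Z,\|\cdot\|_{\hat Z})$ and $(U,\|\cdot\|_U)$ are separable Banach spaces, $Z=\hat Z\times\mathbb{R}^2$ with the product norm $\|\cdot\|_Z$, and elements of $Z$ are written $z=(\hat z,\gamma,\sigma)$; product spaces carry product norms. $\boldsymbol{\xi}$ is a measurable function from a probability space $(\Omega,\mathcal{F},\mathbb{P})$ to a Hilbert space $\Xi$ (of functions on a domain $D\subset\mathbb{R}^d$) with Borel $\sigma$-field, inducing the probability space $(\Xi,\mathcal{B},P)$, taken to be complete; ''a.e. $\xi$'' refers to $P$. Given are $\alpha\in(0,1)$, $\hat A\subset\hat Z$, $\hat f:\hat Z\to\mathbb{R}$, $\hat g_1,\hat g_2:U\times\hat Z\to\mathbb{R}$, and solution mappings $s,s^\nu:\Xi\times\hat Z\to U$, $\nu\in\mathbb{N}$. All of these are regarded also as functions of $z=(\hat z,\gamma,\sigma)\in Z$ by trivial extension (dependence on $\hat z$ only); e.g. $s(\xi,z)=s(\xi,\hat z)$, $\hat g_i(u,z)=\hat g_i(u,\hat z)$. The random variables $\hat g_2(s(\boldsymbol{\xi},\hat z),\hat z)$, $\hat z\in\hat A$, have finite mean. Put $A=\hat A\times\mathbb{R}\times[0,\infty)$, $f(z)=\hat f(\hat z)$, $$g_1(u,z)=\hat g_1(u,\hat z),\qquad g_2(u,z)=\sigma+\gamma+\tfrac1{1-\alpha}\max\{0,\hat g_2(u,\hat z)-\gamma\},$$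 $G(\xi,z)=(g_1(s(\xi,z),z),g_2(s(\xi,z),z))$, $h(w_1,w_2)=w_1+\iota_{\{0\}}(w_2)$, $\psi(z)=\mathbb{E}[g_2(s(\boldsymbol{\xi},z),z)]$, and $$\phi(z)=\iota_A(z)+f(z)+h\big(\mathbb{E}[G(\boldsymbol{\xi},z)]\big),$$ where $\iota_C$ is $0$ on $C$ and $\infty$ off $C$; expectations are assumed well defined and finite, extended arithmetic has $\infty-\infty=\infty$, and $\phi(z)=\infty$ if $z\notin A$. Discretization. For $n\in\mathbb{N}$, $\hat Z^n\subset\hat Z$ and $\hat T_n:\mathbb{R}^n\to\hat Z^n$ is surjective; $Z^n=\hat Z^n\times\mathbb{R}^2$ and $T_n:\mathbb{R}^n\times\mathbb{R}^2\to Z^n$, $T_n(\hat z_n,\gamma,\sigma)=(\hat T_n(\hat z_n),\gamma,\sigma)$. $A_n=\{z_n\mid T_n(z_n)\in A\}$, $f_n(z_n)=f(T_n(z_n))$, $G_n(\xi,z_n)=G(\xi,T_n(z_n))$, $\phi_n(z_n)=\phi(T_n(z_n))$. $\mathbb{B}(\bar z_n,\rho)$ is the closed Euclidean ball of radius $\rho$ centered at $\bar z_n$ in $\mathbb{R}^n\times\mathbb{R}^2$. Approximation. $\operatorname{smax}(t;\beta)=\beta\ln(1+\exp(t/\beta))$ for $t\in\mathbb{R}$, $\beta>0$. For a realization $\xi_1,\xi_2,\dots$ of the sample $\boldsymbol{\xi}_1,\boldsymbol{\xi}_2,\dots$ and $z_n$ with $T_n(z_n)=(\hat z,\gamma,\sigma)$,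 let $$S^\nu(z_n)=\frac1\nu\sum_{j=1}^\nu\Big(\sigma+\gamma+\tfrac1{1-\alpha}\operatorname{smax}\big(\hat g_2(s^\nu(\xi_j,\hat z),\hat z)-\gamma;\beta^\nu\big)\Big),$$ $$\phi_n^\nu(z_n)=\iota_{A_n}(z_n)+\hat f(\hat z)+\frac1\nu\sum_{j=1}^\nu\hat g_1(s^\nu(\xi_j,\hat z),\hat z)+y^\nu S^\nu(z_n)+\theta^\nu\big(S^\nu(z_n)\big)^2 .$$ For $g:Y\to\overline{\mathbb{R}}=[-\infty,\infty]$: $\inf g=\inf_{y\in Y}g(y)$ and $\delta\text{-}\operatorname{argmin} g=\{y\in Y\mid g(y)<\infty,\ g(y)\le\inf g+\delta\}$. Buffered failure probability. For a random variable $\boldsymbol{\eta}$ with finite mean and $a\in(0,1)$, with $Q_a(\boldsymbol{\eta})$ the $a$-quantile, the $a$-superquantile is $\bar Q_a(\boldsymbol{\eta})=Q_a(\boldsymbol{\eta})+\frac1{1-a}\mathbb{E}[\max\{0,\boldsymbol{\eta}-Q_a(\boldsymbol{\eta})\}]$. Then $\text{b-prob}\{\boldsymbol{\eta}>0\}$ equals $0$ if $\text{prob}\{\boldsymbol{\eta}>0\}=0$; equals $1-a$, where $a\in(0,1)$ is the probability with $\bar Q_a(\boldsymbol{\eta})=0$, if $\text{prob}\{\boldsymbol{\eta}>0\}>0$ and $\mathbb{E}[\boldsymbol{\eta}]<0$; and equals $1$ otherwise.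
   Formalization: In condition 3(ii) the bounds on s and s^ν are required for a.e. ξ simultaneously for all z_n∈A_n and ν (exceptional null set independent of z_n); with null sets depending on z_n the claim fails, since s^ν could be altered at sample-dependent points. *)

(* Defs.v *)
From HB Require Import structures.
From mathcomp Require Import all_boot all_order all_algebra.
From mathcomp Require Import all_classical all_reals all_analysis.

Set Implicit Arguments.
Unset Strict Implicit.
Unset Printing Implicit Defensive.
Import Order.TTheory GRing.Theory Num.Theory.
Import numFieldNormedType.Exports.

Local Open Scope classical_set_scope.
Local Open Scope ring_scope.

Definition separable (T : topologicalType) : Prop :=
  exists2 D : set T, countable D & dense D.

(* Together with the completeness carried by [completeNormedModType], this says
   that the norm of [H] is that of a Hilbert space. *)
Definition hilbert_norm (R : realType) (H : normedModType R) : Prop :=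
  exists ip : H -> H -> R,
    [/\ forall x y, ip x y = ip y x,
        forall a x y z, ip (a *: x + y) z = a * ip x z + ip y z
      & forall x, ip x x = `|x| ^+ 2].

Definition borel_type (R : realType) (H : normedModType R) :=
  g_sigma_algebraType (@open H).

Section law.
Context (R : realType) (H : completeNormedModType R).
Context d (Om : measurableType d) (PO : probability Om R).

(* The probability space (H, B, P) induced by a Borel random element: [H] with
   the completion, for the law of [xi], of its Borel sigma-field.  The completion
   is the library's, via the Caratheodory sets of the induced outer measure. *)
Definition law_type (xi : {mfun Om >-> borel_type H}) :=
  caratheodory_type (mu_ext (distribution PO xi))%mu.

Definition law (xi : {mfun Om >-> borel_type H}) : set (law_type xi) -> \bar R :=
  @completed_measure_extension _ _ _ (distribution PO xi).

HB.instance Definition _ (xi : {mfun Om >-> borel_type H}) :=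
  Measure.on (@law xi).

Let law_setT (xi : {mfun Om >-> borel_type H}) : @law xi [set: law_type xi] = 1%E.
Proof.
rewrite /law /completed_measure_extension measurable_mu_extE//.
exact: probability_setT.
Qed.

HB.instance Definition _ (xi : {mfun Om >-> borel_type H}) :=
  Measure_isProbability.Build _ _ _ (@law xi) (law_setT xi).

Lemma law_borel (xi : {mfun Om >-> borel_type H}) (E : set (borel_type H)) :
  measurable E -> @law xi E = PO (xi @^-1` E).
Proof. by move=> mE; rewrite /law /completed_measure_extension measurable_mu_extE. Qed.

Lemma law_complete (xi : {mfun Om >-> borel_type H}) :
  measure_is_complete (@law xi).
Proof. exact: measure_is_complete_caratheodory. Qed.

Definition independent_seq (X : nat -> {mfun Om >-> borel_type H}) : Prop :=
  forall (J : seq nat) (E : nat -> set (borel_type H)), uniq J ->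
    (forall j, measurable (E j)) ->
    PO (\bigcap_(j in [set` J]) (X j @^-1` E j)) =
    (\prod_(j <- J) PO (X j @^-1` E j))%E.

Definition same_law (X Y : {mfun Om >-> borel_type H}) : Prop :=
  forall E : set (borel_type H), measurable E -> PO (X @^-1` E) = PO (Y @^-1` E).
End law.
Arguments law {R H d Om} PO xi _.

Section buffered_probability.
Context (R : realType) d (T : measurableType d) (P : probability T R).

(* Real-valued expectation; the value is meaningful for integrable [X]. *)
Definition mean (X : T -> R) : R := fine 'E_P[X].

Definition quantile (a : R) (eta : T -> R) : R :=
  inf [set x : R | (a%:E <= P [set w | (eta w <= x)%R])%E].

Definition superquantile (a : R) (eta : T -> R) : R :=
  quantile a eta +
  (1 - a)^-1 * mean (fun w => Num.max 0 (eta w - quantile a eta)).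

(* b-prob{eta > 0}; in the second case the level [a] is unique. *)
Definition bprob (eta : T -> R) : R :=
  if P [set w | 0 < eta w]%R == 0%E then 0
  else if mean eta < 0 then
    1 - xget 0 [set a : R | 0 < a < 1 /\ superquantile a eta = 0]
  else 1.
End buffered_probability.

Definition iota_set (R : realType) (T : Type) (C : set T) (x : T) : \bar R :=
  if `[< C x >] then 0%E else +oo%E.
Arguments iota_set {R T} C x.

Definition inf_of (R : realType) (Y : Type) (g : Y -> \bar R) : \bar R :=
  ereal_inf (range g).

Definition delta_argmin (R : realType) (Y : Type) (delta : R) (g : Y -> \bar R)
    : set Y :=
  [set y | (g y < +oo)%E /\ (g y <= inf_of g + delta%:E)%E].

Definition smax (R : realType) (t beta : R) : R :=
  beta * ln (1 + expR (t / beta)).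

(* The closed Euclidean ball of R^n x R^2; the library norms on row vectors and
   on pairs are max-norms. *)
Definition eucl_norm (R : realType) (n : nat) (z : 'rV[R]_n * (R * R)) : R :=
  Num.sqrt (\sum_(i < n) z.1 ord0 i ^+ 2 + z.2.1 ^+ 2 + z.2.2 ^+ 2).

Definition eucl_ball (R : realType) (n : nat) (c : 'rV[R]_n * (R * R)) (rho : R)
    : set ('rV[R]_n * (R * R)) :=
  [set z | eucl_norm (z - c) <= rho].

(* Points of Z = Zhat x R^2 are written z = (zhat, (gamma, sigma)). *)
Section problem.
Context (R : realType) (Zhat U : completeNormedModType R).
Let Z := (Zhat * (R * R))%type.
Context (alpha : R) (Ahat : set Zhat) (fhat : Zhat -> R).
Context (ghat1 ghat2 : U -> Zhat -> R).

Definition feas : set Z := [set z | Ahat z.1 /\ 0 <= z.2.2].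

Definition obj (z : Z) : R := fhat z.1.

Definition g1 (u : U) (z : Z) : R := ghat1 u z.1.

Definition g2 (u : U) (z : Z) : R :=
  z.2.2 + z.2.1 + (1 - alpha)^-1 * Num.max 0 (ghat2 u z.1 - z.2.1).

Definition Gmap (Xi : Type) (s : Xi -> Zhat -> U) (xi : Xi) (z : Z) : R * R :=
  (g1 (s xi z.1) z, g2 (s xi z.1) z).

Definition hfun (w : R * R) : \bar R := (w.1%:E + iota_set [set 0%R] w.2)%E.

Section actual.
Context d (Xi : measurableType d) (P : probability Xi R) (s : Xi -> Zhat -> U).

Definition EG (z : Z) : R * R :=
  (mean P (fun xi => (Gmap s xi z).1), mean P (fun xi => (Gmap s xi z).2)).

Definition psi (z : Z) : R := mean P (fun xi => g2 (s xi z.1) z).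

(* As [obj] and [EG] are real-valued, no sum of infinities of opposite sign
   occurs. *)
Definition phi (z : Z) : \bar R :=
  (iota_set feas z + (obj z)%:E + hfun (EG z))%E.

Definition bp_cost (zhat : Zhat) : R :=
  fhat zhat + mean P (fun xi => ghat1 (s xi zhat) zhat).

Definition bp_feas : set Zhat :=
  [set zhat | Ahat zhat /\
    bprob P (fun xi => ghat2 (s xi zhat) zhat) <= 1 - alpha].

Definition bp_value : \bar R := ereal_inf [set (bp_cost zhat)%:E | zhat in bp_feas].
End actual.

Section discretized.
Context (n : nat) (That : 'rV[R]_n -> Zhat).

Definition Tmap (zn : 'rV[R]_n * (R * R)) : Z := (That zn.1, zn.2).

Definition feas_n : set ('rV[R]_n * (R * R)) := [set zn | feas (Tmap zn)].

Section sample.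
(* [smp j] is the realization of the (j+1)-st element of the sample. *)
Context (Xi : Type) (snu : Xi -> Zhat -> U) (smp : nat -> Xi).
Context (nu : nat) (y theta beta : R).

Definition Snu (zn : 'rV[R]_n * (R * R)) : R :=
  let: (zhat, (gamma, sigma)) := Tmap zn in
  nu%:R^-1 * \sum_(j < nu) (sigma + gamma +
    (1 - alpha)^-1 * smax (ghat2 (snu (smp j) zhat) zhat - gamma) beta).

Definition phi_nu (zn : 'rV[R]_n * (R * R)) : \bar R :=
  let: (zhat, _) := Tmap zn in
  (iota_set feas_n zn +
   (fhat zhat + nu%:R^-1 * \sum_(j < nu) ghat1 (snu (smp j) zhat) zhat +
    y * Snu zn + theta * Snu zn ^+ 2)%R%:E)%E.
End sample.
End discretized.
End problem.

(* Main.v *)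
Require Import Defs.
From HB Require Import structures.
From mathcomp Require Import all_boot all_order all_algebra.
From mathcomp Require Import all_classical all_reals all_analysis.
From mathcomp Require Import ring lra measurable_realfun.

(** Let eta be the random variable ghat2(s(xi, zhat), zhat). By the minimization
    formula for superquantiles, [b-prob{eta > 0} <= 1 - alpha] holds exactly when
    [g + E[max(0, eta - g)] / (1 - alpha) <= 0] for some [g] ([bprob_leP]). So the
    variable gamma turns the constraint on the buffered probability into an
    inequality between expectations, and the slack sigma turns it into the equality
    [psi = 0]; the two problems have the same costs at corresponding feasible
    points, and [tau] is a lower bound for the original one ([tau_le_bp_value]).

    The convergence statement rests on one probabilistic fact
    ([sample_convergence]): at a fixed level [n], almost surely, around each
    feasible point the sample averages of the objective and the smoothed averages
    [S^nu] are eventually uniformly close to the expectations at that point. It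
    combines three estimates. First, a strong law of large numbers
    for integrable functions ([lln_upper]), obtained from a maximal
    argument that uses only that the path of an i.i.d. sample splits into
    its head and an independent tail of the same law. Second, a passage from
    pointwise to locally uniform convergence ([uniform_lln]): the integrands are
    continuous and locally dominated, hence have small expected oscillation on
    small balls, and countably many balls suffice. Third, the Hoelder bounds,
    which make the replacement of [s] by [s^nu] negligible
    ([approximate_solution_lln]), and the bound [beta * ln 2] for the smoothing.
    As the law is completed, integrands are measurable only up to null sets; they
    are replaced by Borel versions before the strong law is applied
    ([sample_average_upper]).

    The rest is deterministic. If [psi(z) < 0] then eventually [S^nu(z) < 0], and
    raising sigma makes [S^nu] vanish, so that the penalties cost nothing; the
    qualification condition makes such points available near every feasible
    one. So the minimal values of the penalized problems do not exceed the
    discretized optimal value in the limit ([recovery]). The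
    penalty with [theta^nu] tending to infinity then forces [psi = 0] at cluster points, and
    there the objective is at most the discretized optimal value plus [delta]
    ([cluster_optimal]). Condition (Q) and the same device of raising
    sigma show that the discretized optimal value is at most [tau + eps] for large [n]
    ([discretized_near_minimizer]), where the bound on [n] depends on [eps] only
    and not on the sample. *)

Set Implicit Arguments.
Unset Strict Implicit.
Unset Printing Implicit Defensive.
Import Order.TTheory GRing.Theory Num.Theory.
Import numFieldNormedType.Exports.
Local Open Scope classical_set_scope.
Local Open Scope ring_scope.

(** * Real-valued integrals over a probability space *)

Section integral_helpers.
Context d (T : measurableType d) (R : realType) (P : probability T R).

Lemma integrable_dominated (f g : T -> R) :
  measurable_fun setT f -> P.-integrable setT (EFin \o g) ->
  (forall x, `|f x| <= g x) -> P.-integrable setT (EFin \o f).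
Proof.
move=> mf ig fg; apply: le_integrable ig => //; first exact/measurable_EFinP.
by move=> x _ /=; rewrite lee_fin (le_trans (fg x)) ?ler_norm.
Qed.

Lemma integrable_measurable (f : T -> R) :
  P.-integrable setT (EFin \o f) -> measurable_fun setT f.
Proof. by move=> /measurable_int/measurable_EFinP. Qed.

Lemma integrable_const (c : R) : P.-integrable setT (EFin \o (fun=> c)).
Proof. exact: finite_measure_integrable_cst. Qed.

Lemma integrable_add (f g : T -> R) :
  P.-integrable setT (EFin \o f) -> P.-integrable setT (EFin \o g) ->
  P.-integrable setT (EFin \o (fun x => f x + g x)).
Proof. by move=> fi gi; have := integrableD measurableT fi gi. Qed.

Lemma integrable_sub (f g : T -> R) :
  P.-integrable setT (EFin \o f) -> P.-integrable setT (EFin \o g) ->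
  P.-integrable setT (EFin \o (fun x => f x - g x)).
Proof. by move=> fi gi; have := integrableB measurableT fi gi. Qed.

Lemma integrable_scale (c : R) (f : T -> R) :
  P.-integrable setT (EFin \o f) ->
  P.-integrable setT (EFin \o (fun x => c * f x)).
Proof. by move=> fi; have := integrableZl measurableT c fi. Qed.

Lemma meanE (f : T -> R) : mean P f = \int[P]_x f x.
Proof. by rewrite /mean unlock. Qed.

Lemma Rintegral_const (c : R) : \int[P]_x c = c.
Proof. by rewrite -meanE /mean (expectation_cst P c). Qed.

Lemma Rintegral_indicator (A : set T) : measurable A ->
  \int[P]_x \1_A x = fine (P A).
Proof. by move=> mA; rewrite /Rintegral integral_indic// setIT. Qed.

Lemma Rintegral_eq0_ae (f : T -> R) : P.-integrable setT (EFin \o f) ->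
  (forall x, 0 <= f x) -> \int[P]_x f x <= 0 -> {ae P, forall x, f x = 0}.
Proof.
move=> fi f0 If.
have mf := integrable_measurable fi.
have /ae_eq_integral_abs : measurable_fun setT (EFin \o f) by exact/measurable_EFinP.
move=> /(_ P measurableT)[+ _].
have -> : (\int[P]_x `|(EFin \o f) x| = 0)%E.
  transitivity (\int[P]_x (f x)%:E)%E.
    by apply: eq_integral => x _ /=; rewrite ger0_norm.
  rewrite -[LHS]fineK ?integrable_fin_num//; congr EFin.
  by apply/le_anti; rewrite If Rintegral_ge0.
by move=> /(_ erefl); apply: filterS => x /(_ I)[].
Qed.

End integral_helpers.

(** * Expected shortfall and superquantiles *)

Section shortfall.
Context d (T : measurableType d) (R : realType) (P : probability T R).
Variable eta : T -> R.
Hypothesis ieta : P.-integrable setT (EFin \o eta).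

Definition shortfall (g : R) : R := \int[P]_w Num.max 0 (eta w - g).

Let meta : measurable_fun setT eta := integrable_measurable ieta.

Lemma integrable_excess g :
  P.-integrable setT (EFin \o (fun w => Num.max 0 (eta w - g))).
Proof.
apply: (@integrable_dominated _ _ _ _ _ (fun w => `|eta w| + `|g|)).
- by apply: measurable_maxr => //; apply: measurable_funB.
- have := integrableD measurableT (integrable_norm ieta) (integrable_const P `|g|).
  exact.
- move=> w; rewrite ger0_norm ?le_max ?lexx// ge_max addr_ge0//=.
  by rewrite (le_trans (ler_norm _)) ?ler_normB.
Qed.

Lemma shortfall_ge0 g : 0 <= shortfall g.
Proof. by apply: Rintegral_ge0 => w _; rewrite le_max lexx. Qed.

Definition tail_prob x : R := fine (P [set w | x < eta w]).

Let mtail x : measurable [set w | x < eta w].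
Proof.
rewrite -[X in measurable X]setTI.
rewrite (_ : [set w | x < eta w] = eta @^-1` `]x, +oo[%classic); last first.
  by apply/seteqP; split=> w /=; rewrite in_itv/= andbT.
exact: meta.
Qed.

(** The shortfall is convex in the threshold, and [- tail_prob x] is one of
    its subgradients at [x]. The monotonicity, Lipschitz and minimality
    properties used later all come from this one inequality, which holds
    pointwise before taking expectations. *)
Lemma shortfall_subgrad x g :
  shortfall x + (x - g) * tail_prob x <= shortfall g.
Proof.
have itail : P.-integrable setT (EFin \o (\1_[set w | x < eta w] : T -> R)).
  by apply: integrable_indic.
rewrite /tail_prob -Rintegral_indicator// -RintegralZl// -RintegralD//; last 2 first.
- exact: integrable_excess.
- exact: integrable_scale.
apply: le_Rintegral => //; last 2 first.
- exact: integrable_excess.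
- move=> w _; rewrite indicE.
  have [xw|xw] := ltP x (eta w).
  + rewrite mem_set//= mulr1 maxEle maxEle; do 2 case: ifPn; lra.
  + rewrite memNset/= ?mulr0 ?addr0; last by apply/negP; rewrite -leNgt.
    rewrite maxEle maxEle; do 2 case: ifPn; lra.
apply: integrable_add; first exact: integrable_excess.
exact: integrable_scale.
Qed.

Lemma tail_prob_ge0 x : 0 <= tail_prob x. Proof. exact: fine_ge0. Qed.

Lemma tail_prob_le1 x : tail_prob x <= 1.
Proof. by rewrite -lee_fin fineK ?fin_num_measure// probability_le1. Qed.

Lemma shortfall_lipschitz x g : shortfall x <= shortfall g + `|x - g|.
Proof.
have := shortfall_subgrad x g; have := tail_prob_le1 x; have := tail_prob_ge0 x.
have [h|h] := ger0P (x - g); nra.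
Qed.

Lemma mean_sub_le_shortfall g : mean P eta - g <= shortfall g.
Proof.
rewrite meanE -[X in _ - X <= _](Rintegral_const P g) -RintegralB//; last first.
  exact: integrable_const.
apply: le_Rintegral => //; last 2 first.
- exact: integrable_excess.
- by move=> w _; rewrite le_max lexx orbT.
exact: integrable_sub ieta (integrable_const _ _).
Qed.

Lemma shortfall0_gt0 : P [set w | 0 < eta w] <> 0%E -> 0 < shortfall 0.
Proof.
move=> P0; rewrite lt_neqAle shortfall_ge0 andbT; apply/eqP => s0; apply: P0.
have /Rintegral_eq0_ae -/(_ _ _)[] := integrable_excess 0.
- by move=> x; rewrite le_max lexx.
- by rewrite -/(shortfall 0) -s0.
move=> N [mN N0 sN]; apply/eqP; rewrite -measure_le0 -N0; apply: le_measure.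
- by rewrite inE; apply: mtail.
- by rewrite inE.
- apply: subset_trans sN => w /= ew; rewrite subr0 maxEle (ltW ew) => e0.
  by move: ew; rewrite e0 ltxx.
Qed.

Lemma shortfall_neg l : 0 < l ->
  l * shortfall (- l^-1) = \int[P]_w Num.max 0 (l * eta w + 1).
Proof.
move=> l0; rewrite -RintegralZl//; last exact: integrable_excess.
apply: eq_Rintegral => w _; rewrite maxr_pMr ?mulr0 ?ltW//.
by congr Num.max; rewrite opprK mulrDr divff// gt_eqF.
Qed.

(** The distribution function tends to 0 and to 1, so the infimum defining
    the quantile is a genuine one. *)
Lemma quantile_has_inf a : 0 < a < 1 ->
  has_inf [set x : R | (a%:E <= P [set w | (eta w <= x)%R])%E].
Proof.
move=> /andP[a0 a1].
pose X : {RV P >-> R} := HB.pack eta (isMeasurableFun.Build _ _ _ _ _ meta).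
have cdfE x : cdf X x = P [set w | (eta w <= x)%R].
  by congr (P _); apply/seteqP; split=> w /=; rewrite in_itv.
split.
- have /= := @cvg_cdfy1 _ _ _ P X.
  move=> /(_ [set x | (a%:E < x)%E])/=; case.
    by apply: open_nbhs_nbhs; split; [exact: open_ereal_gt_ereal|rewrite /= lte_fin].
  move=> M [_ HM]; exists (M + 1) => /=; rewrite -cdfE.
  by apply/ltW/HM; rewrite ltrDl.
- have /= := @cvg_cdfNy0 _ _ _ P X.
  move=> /(_ [set x | (x < a%:E)%E])/=; case.
    by apply: open_nbhs_nbhs; split; [exact: open_ereal_lt_ereal|rewrite /= lte_fin].
  move=> M [_ HM]; exists M => x /=; rewrite -cdfE.
  by rewrite leNgt => xa; rewrite leNgt; apply: contra xa => /HM.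
Qed.

Lemma tail_prob_le_level a x :
  (tail_prob x <= 1 - a) = (a%:E <= P [set w | (eta w <= x)%R])%E.
Proof.
have E : [set w | eta w <= x] = ~` [set w | x < eta w].
  by apply/seteqP; split=> w /=; rewrite leNgt => /negP.
rewrite E probability_setC// -[P _]fineK ?fin_num_measure//.
by rewrite -EFinB lee_fin lerBrDl -lerBrDr.
Qed.

(** The minimization formula of Rockafellar and Uryasev: the superquantile is
    the value at the quantile [Q] of [g |-> g + shortfall g / (1 - a)], and [Q]
    minimizes that function. By the subgradient inequality the function
    decreases on the left of [Q], where the tail probability is at least
    [1 - a], and increases from points with tail probability at most [1 - a];
    as it is Lipschitz, approaching [Q] through such points suffices. *)
Lemma superquantile_le a g : 0 < a < 1 ->
  superquantile P a eta <= g + (1 - a)^-1 * shortfall g.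
Proof.
move=> a01; have [a0 a1] := andP a01.
rewrite /superquantile meanE -/(shortfall _).
set Q := quantile P a eta; have hS := quantile_has_inf a01.
have b0 : 0 < 1 - a by rewrite subr_gt0.
(* After multiplication by [1 - a] the claim is that [Q] minimizes
   [(1 - a) * g + shortfall g]. *)
suff : (1 - a) * Q + shortfall Q <= (1 - a) * g + shortfall g.
  by move=> h; rewrite -(ler_pM2l b0) !mulrDr !mulrA divff ?gt_eqF// !mul1r.
apply/ler_addgt0Pr => e e0.
have Sx x : (tail_prob x <= 1 - a) = (a%:E <= P [set w | (eta w <= x)%R])%E.
  exact: tail_prob_le_level.
have Sy x : x < Q -> 1 - a <= tail_prob x.
  move=> xQ; rewrite leNgt; apply/negP => /ltW; rewrite Sx => /(ge_inf hS.2).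
  by rewrite leNgt xQ.
have key x : `|x - Q| <= e / 3 -> (1 - a) * x + shortfall x <= (1 - a) * g + shortfall g ->
   (1 - a) * Q + shortfall Q <= (1 - a) * g + shortfall g + e.
  move=> xQ h; have := shortfall_lipschitz Q x; rewrite distrC.
  have : (1 - a) * (Q - x) <= `|x - Q|.
    have := ler_norm (Q - x); have := normr_ge0 (Q - x); rewrite (distrC x); nra.
  lra.
have [gQ|Qg] := ltP g Q.
- pose x := Num.max g (Q - e / 3).
  have gx : g <= x by rewrite le_max lexx.
  have xQ : x < Q by rewrite gt_max gQ/=; lra.
  apply: (key x).
    rewrite distrC ger0_norm ?subr_ge0 ?(ltW xQ)//.
    by rewrite lerBlDl -lerBlDr le_max lexx orbT.
  have := shortfall_subgrad x g; have := Sy _ xQ; nra.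
- have [/= x xS xQ] := inf_adherent (divr_gt0 e0 (ltr0n R 3)) hS.
  have Qx : Q <= x by exact: (ge_inf hS.2).
  have [gx|xg] := leP g x; last first.
    apply: (key x); first by rewrite ger0_norm ?subr_ge0 // lerBlDl ltW.
    have := shortfall_subgrad x g; have := xS; rewrite /= -Sx; nra.
  have : (1 - a) * Q <= (1 - a) * g by rewrite ler_pM2l.
  have := shortfall_lipschitz Q g; rewrite distrC ger0_norm ?subr_ge0//.
  have : g - Q <= e / 3 by rewrite lerBlDl (le_trans gx)// ltW.
  lra.
Qed.
End shortfall.

Section dct.
Context d (T : measurableType d) (R : realType) (P : probability T R).

Lemma Rintegral_dominated_cvg (f : nat -> T -> R) (g c : T -> R) :
  (forall n, measurable_fun setT (f n)) -> measurable_fun setT g ->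
  P.-integrable setT (EFin \o c) ->
  {ae P, forall x, f ^~ x @ \oo --> g x} ->
  {ae P, forall x, forall n, `|f n x| <= c x} ->
  (fun n => \int[P]_x f n x) @ \oo --> \int[P]_x g x.
Proof.
move=> mf mg ic fg fc.
have [||||ig _] := @dominated_convergence _ _ _ P setT measurableT
  (fun n => EFin \o f n) (EFin \o g) (EFin \o c) _ _ _ ic _.
- by move=> n; exact/measurable_EFinP.
- exact/measurable_EFinP.
- by apply: filterS fg => x h _; apply: cvg_EFin h; exact: nearW.
- by apply: filterS fc => x h n _; rewrite /= lee_fin.
have -> : (\int[P]_x (EFin \o g) x)%E = (\int[P]_x g x)%:E.
  by rewrite fineK// integrable_fin_num.
exact: fine_cvg.
Qed.
End dct.

(** * Buffered failure probability *)

Section buffered.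
Context d (T : measurableType d) (R : realType) (P : probability T R).
Variable eta : T -> R.
Hypothesis ieta : P.-integrable setT (EFin \o eta).

Let meta : measurable_fun setT eta := integrable_measurable ieta.

(** For [l = - 1 / g] with [g < 0] this is [shortfall g / (- g)]. Minimizing it
    over [l >= 0] yields the buffered probability; the parametrization by [l]
    replaces an unbounded range of thresholds by a compact one. *)
Definition scaled_excess (l : R) : R := \int[P]_w Num.max 0 (l * eta w + 1).

Lemma integrable_scaled_excess l :
  P.-integrable setT (EFin \o (fun w => Num.max 0 (l * eta w + 1))).
Proof.
apply: (@integrable_dominated _ _ _ _ _ (fun w => `|l| * `|eta w| + 1)).
- apply: measurable_maxr => //; apply: measurable_funD => //.
  exact: measurable_funM.
- apply: integrable_add (integrable_const _ _).
  exact: integrable_scale (integrable_norm ieta).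
- move=> w; rewrite ger0_norm ?le_max ?lexx// ge_max addr_ge0//=.
  by rewrite lerD2r -normrM ler_norm.
Qed.

Lemma scaled_excess_continuous : continuous scaled_excess.
Proof.
move=> l; apply/cvgrPdist_le => e e0.
pose M := \int[P]_w `|eta w|.
have M0 : 0 <= M by exact: Rintegral_ge0.
have M1 : 0 < M + 1 by rewrite ltr_wpDl.
near=> t.
rewrite -RintegralB//; try exact: integrable_scaled_excess.
have h : `|l - t| <= e / (M + 1) by near: t; apply: cvgr_dist_le; rewrite ?divr_gt0.
apply: le_trans (le_normr_Rintegral _ _) _ => //.
  exact: integrable_sub (integrable_scaled_excess l) (integrable_scaled_excess t).
apply: (@le_trans _ _ (\int[P]_w (`|l - t| * `|eta w|))).
  apply: le_Rintegral => //.
  - apply: (@integrable_norm _ _ _ P setT (fun w =>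
      Num.max 0 (l * eta w + 1) - Num.max 0 (t * eta w + 1))).
    exact: integrable_sub (integrable_scaled_excess l) (integrable_scaled_excess t).
  - exact: integrable_scale (integrable_norm ieta).
  - move=> w _; rewrite -normrM mulrBl.
    set u := l * _; set v := t * _; rewrite ler_norml !maxEle.
    have := ler_norm (u - v); have := ler_norm (v - u); rewrite (distrC v).
    by case: ifPn; case: ifPn; rewrite -?ltNge; lra.
rewrite RintegralZl//; last exact: integrable_norm.
apply: (@le_trans _ _ (e / (M + 1) * M)); first by rewrite ler_wpM2r.
by rewrite mulrAC ler_pdivrMr// ler_wpM2l ?ltW// ltrDl.
Unshelve. all: by end_near. Qed.

(** The right derivative at [l = 0] is the mean: writing [l = 1 / (n + 1)],
    [scaled_excess l = 1 + l * E[max(- (n + 1), eta)]], and these truncated means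
    converge to the negative mean of [eta]. *)
Lemma scaled_excess_lt1 : mean P eta < 0 -> exists2 l, 0 < l & scaled_excess l < 1.
Proof.
rewrite meanE => e0.
have cvi : (fun n => \int[P]_w Num.max (- n.+1%:R) (eta w)) @ \oo -->
    \int[P]_w eta w.
  apply: (@Rintegral_dominated_cvg _ _ _ P
    (fun n w => Num.max (- n.+1%:R) (eta w)) eta (fun w => `|eta w|)) => //.
  - by move=> n; exact: measurable_maxr.
  - exact: integrable_norm.
  - apply: aeW => w; apply: cvg_near_cst; near=> n.
    apply/max_idPr; rewrite lerNl (le_trans (ler_norm _))// normrN.
    apply: le_trans (_ : n%:R <= _); last by rewrite ler_nat.
    by near: n; exact: nbhs_infty_ger.
  - apply: aeW => w n; rewrite maxEle; case: ifPn => //.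
    rewrite -ltNge => h; have n0 : (0 : R) < n.+1%:R by [].
    rewrite ler0_norm ?oppr_le0 ?ltW//; have := ler_norm (- eta w); rewrite normrN; lra.
have [|N _ HN] := cvi [set x | x < 0].
  by apply: open_nbhs_nbhs; split => //; exact: open_lt.
have n0 : (0 : R) < N.+1%:R by [].
exists N.+1%:R^-1; first by rewrite invr_gt0.
have -> : scaled_excess N.+1%:R^-1 =
    1 + N.+1%:R^-1 * \int[P]_w Num.max (- N.+1%:R) (eta w).
  have im : P.-integrable setT (EFin \o (fun w => Num.max (- N.+1%:R) (eta w))).
    apply: (@integrable_dominated _ _ _ _ _ (fun w => `|eta w|)).
    - exact: measurable_maxr.
    - exact: integrable_norm.
    - move=> w; rewrite maxEle; case: ifPn => //.
      rewrite -ltNge => h.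
      rewrite ler0_norm ?oppr_le0 ?ltW//; have := ler_norm (- eta w); rewrite normrN; lra.
  rewrite -[X in X + _](Rintegral_const P) -RintegralZl// -RintegralD//.
  - apply: eq_Rintegral => w _; rewrite maxr_pMr ?invr_ge0 ?ltW//.
    rewrite mulrN mulVf ?gt_eqF// [RHS]addrC maxEle maxEle.
    set v := _^-1 * _; case: (leP 0 (v + 1)); case: (leP (-1) v); lra.
  - exact: integrable_const.
  - exact: integrable_scale.
have := HN N (leqnn N); rewrite /= => h; rewrite gtrDl pmulr_rlt0 ?invr_gt0//.
Unshelve. all: by end_near. Qed.

Lemma shortfall_scaled l : 0 < l ->
  shortfall P eta (- l^-1) = l^-1 * scaled_excess l.
Proof.
move=> l0; rewrite /scaled_excess -(shortfall_neg ieta l0) mulrA mulVf ?mul1r//.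
by rewrite gt_eqF.
Qed.

Lemma scaled_excess_ge l : 0 < l -> l * shortfall P eta 0 <= scaled_excess l.
Proof.
move=> l0; rewrite /scaled_excess -(shortfall_neg ieta l0) ler_pM2l//.
have := shortfall_subgrad ieta 0 (- l^-1).
have : 0 <= l^-1 by rewrite invr_ge0 ltW.
have := tail_prob_ge0 P eta 0; nra.
Qed.

(** The level is [1 - p] with [p] the minimum of [scaled_excess]. The minimum is
    attained in the interior: [scaled_excess] is 1 at 0, falls below 1 because
    the mean is negative, and exceeds 1 for large [l] because
    [eta] is positive with positive probability. At that level the function
    minimized by the superquantile is nonnegative and vanishes at [- 1 / l]. *)
Lemma level_exists : P [set w | 0 < eta w]%R <> 0%E -> mean P eta < 0 ->
  exists a, 0 < a < 1 /\ superquantile P a eta = 0.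
Proof.
move=> /(shortfall0_gt0 ieta) H0 /scaled_excess_lt1[l l0 Kl].
pose K := scaled_excess; pose L := (shortfall P eta 0)^-1.
have L0 : 0 < L by rewrite invr_gt0.
have KL t : L <= t -> 1 <= K t.
  move=> Lt; have t0 : 0 < t by exact: lt_le_trans Lt.
  apply: le_trans (scaled_excess_ge t0).
  by rewrite -(mulVf (lt0r_neq0 H0)) ler_pM2r.
have [m] := EVT_min (ltW L0) (continuous_subspaceT scaled_excess_continuous).
rewrite in_itv/= => /andP[m0 mL] Km.
have Kmin t : 0 <= t -> K m <= K t.
  move=> t0; have [tL|Lt] := leP t L; first by apply: Km; rewrite in_itv/= t0.
  apply: le_trans (KL _ (ltW Lt)); apply: le_trans (ltW Kl).
  apply: Km; rewrite in_itv/= ltW//= leNgt; apply/negP => /ltW/KL.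
  by rewrite /K leNgt Kl.
have Km1 : K m < 1 by exact: le_lt_trans (Kmin _ (ltW l0)) Kl.
have {}m0 : 0 < m.
  rewrite lt_neqAle m0 andbT; apply/eqP => m0'.
  move: Km1; rewrite -m0' /K /scaled_excess.
  rewrite (_ : \int[P]_w _ = 1) ?ltxx// -[RHS](Rintegral_const P).
  by apply: eq_Rintegral => w _; rewrite mul0r add0r; apply/max_idPr.
have Km0 : 0 < K m by apply: lt_le_trans (scaled_excess_ge m0); rewrite mulr_gt0.
have a01 : 0 < 1 - K m < 1 by lra.
exists (1 - K m); split => //.
(* [<= 0] by testing the minimization formula at the threshold [- 1 / m];
   [>= 0] because [K m] is the minimum. *)
have Kinv : 1 - (1 - K m) = K m by lra.
apply/le_anti/andP; split.
  apply: le_trans (superquantile_le ieta (- m^-1) a01) _.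
  rewrite Kinv shortfall_scaled// mulrCA mulVf ?gt_eqF// mulr1; lra.
rewrite /superquantile meanE -/(shortfall P eta _) Kinv.
set q := quantile _ _ _.
have [q0|q0] := leP 0 q.
  by apply: addr_ge0 => //; apply: mulr_ge0; [rewrite invr_ge0 ltW|exact: shortfall_ge0].
pose t := - q^-1; have t0 : 0 < t by rewrite oppr_gt0 invr_lt0.
have -> : q = - t^-1 by rewrite /t invrN invrK opprK.
rewrite shortfall_scaled// addrC subr_ge0 mulrCA ler_pMr ?invr_gt0//.
rewrite mulrC ler_pdivlMr// mul1r; exact: Kmin (ltW t0).
Qed.

(** Lowering the level decreases [g + shortfall g / (1 - a)] strictly wherever
    the shortfall is positive, so a nonpositive value at level [alpha] would make
    the superquantile negative at any smaller level. *)
Lemma level_ge a alpha g : 0 < a < 1 -> 0 < alpha < 1 ->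
  P [set w | 0 < eta w]%R <> 0%E -> superquantile P a eta = 0 ->
  g + (1 - alpha)^-1 * shortfall P eta g <= 0 -> alpha <= a.
Proof.
move=> a01 al01 P0 qa ga; rewrite leNgt; apply/negP => aal.
have := superquantile_le ieta g a01; rewrite qa.
have [a0 a1] := andP a01; have [al0 al1] := andP al01.
have b0 : 0 < 1 - a by lra.
have c0 : 0 < 1 - alpha by lra.
have bc : (1 - a)^-1 < (1 - alpha)^-1 by rewrite ltf_pV2// ?posrE//; lra.
have H0 := shortfall_ge0 P eta g.
have [Hg|Hg] := eqVneq (shortfall P eta g) 0; last first.
  have {Hg}H0 : 0 < shortfall P eta g by rewrite lt_neqAle eq_sym Hg.
  have : (1 - a)^-1 * shortfall P eta g < (1 - alpha)^-1 * shortfall P eta g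
    by rewrite ltr_pM2r.
  lra.
have := shortfall0_gt0 ieta P0; move: ga.
have := shortfall_subgrad ieta 0 g; rewrite Hg !mulr0.
have := tail_prob_ge0 P eta 0; nra.
Qed.

(** The bound on the buffered probability as an inequality that involves only
    expectations; the auxiliary variable [g] is the one that the
    reformulated problem optimizes over. *)
Lemma bprob_leP alpha : 0 < alpha < 1 ->
  bprob P eta <= 1 - alpha <->
  exists g, g + (1 - alpha)^-1 * shortfall P eta g <= 0.
Proof.
move=> al01; have [al0 al1] := andP al01.
have c0 : 0 < 1 - alpha by lra.
rewrite /bprob; case: ifPn => [/eqP P0|/eqP P0].
  split => [_|_]; last exact: ltW.
  exists 0; rewrite add0r (_ : shortfall P eta 0 = 0) ?mulr0//.
  rewrite /shortfall -[RHS](Rintegral_const P); congr fine.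
  apply: ae_eq_integral => //.
  - exact: measurable_int (integrable_excess ieta 0).
  - exists [set w | 0 < eta w]; split => //.
    + rewrite -[X in measurable X]setTI.
      rewrite (_ : [set w | 0 < eta w] = eta @^-1` `]0, +oo[%classic); last first.
        by apply/seteqP; split=> w /=; rewrite in_itv/= andbT.
      exact: meta.
    + move=> w /= h; rewrite ltNge; apply/negP => ew; apply: h => _.
      by rewrite subr0; congr EFin; apply/max_idPl.
case: ifPn => [m0|]; last first.
  rewrite -leNgt => m0; split; first by lra.
  move=> [g ga]; exfalso.
  have Hg0 := shortfall_ge0 P eta g.
  (* With a nonnegative mean, Jensen's inequality forces [g = 0] and then
     a zero shortfall at 0. *)
  have Hg : (1 - alpha) * g + shortfall P eta g <= 0.
    by move: ga; rewrite -(ler_pM2l c0) mulrDr mulrA divff ?mul1r ?mulr0 ?gt_eqF.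
  have := mean_sub_le_shortfall ieta g; have := shortfall0_gt0 ieta P0.
  have := shortfall_subgrad ieta 0 g; have := tail_prob_ge0 P eta 0.
  move=> t0 h1 h2 h3; have g0 : g = 0 by nra.
  move: Hg h1 h2; rewrite g0; lra.
set S := [set a : R | _].
have /(xgetPex 0) : exists a, S a by exact: level_exists.
set a := xget 0 S => -[a01 qa].
have [a0 a1] := andP a01.
rewrite lerD2l lerN2; split => [ala|[g ga]]; last exact: level_ge ga.
exists (quantile P a eta).
apply: le_trans (_ : superquantile P a eta <= 0); last by rewrite qa.
rewrite /superquantile meanE -/(shortfall P eta _) lerD2l ler_wpM2r//.
  exact: shortfall_ge0.
by rewrite lef_pV2 ?posrE; lra.
Qed.
End buffered.

(** * Sequence space and the law of an i.i.d. sequence *)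

Section sequence_space.
Context d (T : measurableType d).

(** The constraints are indexed by all of [nat] and become trivial from some
    rank on; in this form two cylinders intersect componentwise. *)
Definition cylinder : set (set (nat -> T)) := [set A | exists n E,
  [/\ forall j, measurable (E j), forall j, (n <= j)%N -> E j = setT
    & A = [set x : nat -> T | forall j, E j (x j)]]].

Definition seq_space : measurableType cylinder.-sigma := g_sigma_algebraType cylinder.

Definition shift (x : seq_space) : seq_space := fun j => x j.+1.

Lemma cylinder_setI : setI_closed cylinder.
Proof.
move=> _ _ [n [E [mE En ->]]] [m [F [mF Fm ->]]].
exists (maxn n m), (fun j => E j `&` F j); split.
- by move=> j; exact: measurableI.
- by move=> j; rewrite geq_max => /andP[nj mj]; rewrite En// Fm// setIT.
- apply/seteqP; split=> x /=; first by move=> [Ex Fx] j.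
  by move=> EF; split=> j; have [] := EF j.
Qed.

Lemma cylinder_setT : cylinder setT.
Proof. by exists 0%N, (fun=> setT); split => //; apply/seteqP. Qed.

Lemma measurable_coord j : measurable_fun setT (fun x : seq_space => x j).
Proof.
move=> _ A mA; rewrite setTI; apply: sub_sigma_algebra.
exists j.+1, (fun i => if i == j then A else setT); split.
- by move=> i; case: ifP.
- by move=> i ji; rewrite gtn_eqF.
- apply/seteqP; split=> x /=; first by move=> Ax i; case: ifPn => // /eqP ->.
  by move=> /(_ j); rewrite eqxx.
Qed.

Lemma measurable_to_seq d' (S : measurableType d') (f : S -> seq_space) :
  (forall j, measurable_fun setT (fun w => f w j)) -> measurable_fun setT f.
Proof.
move=> mf; apply: (@measurability _ _ S seq_space setT f cylinder) => //.
move=> _ [_ [n [E [mE _ ->]]] <-]; rewrite setTI.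
rewrite (_ : _ @^-1` _ = \bigcap_j ((fun w => f w j) @^-1` E j)).
  apply: bigcapT_measurable => j; rewrite -[X in measurable X]setTI.
  exact: mf.
by apply/seteqP; split=> x /= h j => [_|]; exact: h.
Qed.

Lemma measurable_shift : measurable_fun setT shift.
Proof. by apply: measurable_to_seq => j; exact: measurable_coord. Qed.

End sequence_space.

Section iid_sequence.
Context d d' (T : measurableType d) (Om : measurableType d') (R : realType).
Context (PO : probability Om R) (X : nat -> {mfun Om >-> T}).
Hypothesis indep : forall (J : seq nat) (E : nat -> set T), uniq J ->
  (forall j, measurable (E j)) ->
  PO (\bigcap_(j in [set` J]) (X j @^-1` E j)) =
  (\prod_(j <- J) PO (X j @^-1` E j))%E.
Hypothesis same : forall j E, measurable E -> PO (X j @^-1` E) = PO (X 0%N @^-1` E).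

Definition sample_path (w : Om) : seq_space T := fun j => X j w.

Lemma measurable_sample_path : measurable_fun setT sample_path.
Proof. by apply: measurable_to_seq => j; exact: measurable_funPT. Qed.

HB.instance Definition _ :=
  isMeasurableFun.Build _ _ _ _ sample_path measurable_sample_path.

Definition path_law : probability (seq_space T) R := distribution PO sample_path.

Lemma path_law_cylinder n (E : nat -> set T) : (forall j, measurable (E j)) ->
  (forall j, (n <= j)%N -> E j = setT) ->
  path_law [set x | forall j, E j (x j)] =
  (\prod_(0 <= j < n) PO (X 0%N @^-1` E j))%E.
Proof.
move=> mE En; rewrite /path_law /distribution /pushforward/=.
transitivity (PO (\bigcap_(j in [set` iota 0 n]) (X j @^-1` E j))).
  congr (PO _); apply/seteqP; split=> w /= h j; first by move=> _; exact: h.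
  have [nj|jn] := leqP n j; first by rewrite En.
  by apply: h; rewrite /= mem_iota.
rewrite indep ?iota_uniq// /index_iota subn0.
by apply: eq_bigr => j _; rewrite same.
Qed.

(** The first observation is independent of the shifted path, and the shifted
    path has the law of the path itself: on cylinders this is the product
    formula for finitely many coordinates, and cylinders form a pi-system. *)
Lemma path_law_split A B : measurable A -> measurable B ->
  path_law [set x | A (x 0%N) /\ B (shift x)] =
  (PO (X 0%N @^-1` A) * path_law B)%E.
Proof.
move=> mA mB.
have mA0 : measurable ((fun x : seq_space T => x 0%N) @^-1` A).
  by rewrite -[X in measurable X]setTI; exact: measurable_coord.
have mX0 : measurable (X 0%N @^-1` A).
  by rewrite -[X in measurable X]setTI; exact: measurable_funPT.
have p0 : 0 <= fine (PO (X 0%N @^-1` A)) by exact: fine_ge0.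
have pE : PO (X 0%N @^-1` A) = (fine (PO (X 0%N @^-1` A)))%:E.
  by rewrite fineK// fin_num_measure.
pose m1' : measure (seq_space T) R := pushforward (mrestr path_law mA0) (@shift _ T).
pose m1 := m1' (@measurable_shift _ T).
pose m2 : measure (seq_space T) R := mscale (NngNum p0) path_law.
have m1E D : m1 D = path_law (@shift _ T @^-1` D `&` (fun x : seq_space T => x 0%N) @^-1` A).
  by [].
have m2E D : m2 D = (PO (X 0%N @^-1` A) * path_law D)%E by rewrite pE.
have := @measure_unique _ _ (seq_space T) (@cylinder _ T) (fun=> setT) erefl
  (@cylinder_setI _ T) (fun=> @cylinder_setT _ T) _ m1 m2.
rewrite bigcup_const// => /(_ erefl _ _ B mB) h.
transitivity (m1 B).
  rewrite m1E; congr (path_law _).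
  by apply/seteqP; split=> x /= [].
rewrite h.
- exact: m2E.
- move=> _ [n [E [mE En ->]]].
  rewrite m1E m2E (path_law_cylinder mE En).
  pose F j := if j is k.+1 then E k else A.
  rewrite (_ : _ `&` _ = [set x | forall j, F j (x j)]); last first.
    apply/seteqP; split=> x /=; first by move=> [h1 h2] [|j]//; exact: h1.
    by move=> h1; split=> [j|]; [exact: (h1 j.+1)|exact: (h1 0%N)].
  rewrite (@path_law_cylinder n.+1 F).
  + by rewrite big_nat_recl.
  + by case.
  + by case => // k /=; exact: En.
- move=> _; rewrite m1E.
  apply: le_lt_trans (_ : path_law setT < +oo)%E.
    by apply: le_measure; rewrite ?inE//; rewrite preimage_setT setTI.
  by rewrite probability_setT ltry.
Qed.

Definition head_tail (x : seq_space T) := (x 0%N, shift x).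

Lemma measurable_head_tail : measurable_fun setT head_tail.
Proof. by apply: measurable_fun_pair; [exact: measurable_coord|exact: measurable_shift]. Qed.

HB.instance Definition _ :=
  isMeasurableFun.Build _ _ _ _ head_tail measurable_head_tail.

(** The map sending a path to its head and its tail carries the path law to the
    product of the one-dimensional law and the path law. Independence and
    stationarity both follow by Fubini. *)
Lemma integral_head_tail (f : T * seq_space T -> \bar R) :
  measurable_fun setT f -> (forall x, 0 <= f x)%E ->
  (\int[path_law]_x f (x 0%N, shift x) =
   \int[(distribution PO (X 0%N) \x path_law)%E]_z f z)%E.
Proof.
move=> mf f0.
have -> : (\int[path_law]_x f (x 0%N, shift x) =
    \int[distribution path_law head_tail]_z f z)%E.
  by rewrite ge0_integral_distribution.
apply: eq_measure_integral => A mA _; apply/esym.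
apply: (@product_measure_unique _ _ _ _ _ (distribution PO (X 0%N)) path_law
  (distribution path_law head_tail)) => //.
by move=> {mA}A B mA mB; exact: path_law_split.
Qed.

Lemma integral_head_tail_prod (f : T -> R) (g : seq_space T -> R) :
  measurable_fun setT f -> measurable_fun setT g ->
  (forall x, 0 <= f x) -> (forall x, 0 <= g x) ->
  (\int[path_law]_x (f (x 0%N) * g (shift x))%:E =
   (\int[PO]_w (f (X 0%N w))%:E) * \int[path_law]_x (g x)%:E)%E.
Proof.
move=> mf mg f0 g0.
rewrite (integral_head_tail (f := fun z => (f z.1 * g z.2)%:E)); last 2 first.
- apply/measurable_EFinP; apply: measurable_funM.
    exact: measurableT_comp mf measurable_fst.
  exact: measurableT_comp mg measurable_snd.
- by move=> x; rewrite lee_fin mulr_ge0.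
rewrite fubini_tonelli1; last 2 first.
- apply/measurable_EFinP; apply: measurable_funM.
    exact: measurableT_comp mf measurable_fst.
  exact: measurableT_comp mg measurable_snd.
- by move=> x; rewrite lee_fin mulr_ge0.
rewrite /fubini_F.
under eq_integral => a _.
  rewrite (_ : (\int[path_law]_y _)%E = ((f a)%:E * \int[path_law]_x (g x)%:E)%E);
    last first.
    rewrite -ge0_integralZl//; last 3 first.
    - exact/measurable_EFinP.
    - by move=> x _; rewrite lee_fin.
    - by rewrite lee_fin.
  over.
rewrite ge0_integralZr//; last 3 first.
- exact/measurable_EFinP.
- by move=> x _; rewrite lee_fin.
- by apply: integral_ge0 => x _; rewrite lee_fin.
by congr (_ * _)%E; rewrite ge0_integral_distribution//; exact/measurable_EFinP.
Qed.

Lemma Rintegral_head_tail (f : T -> R) (g : seq_space T -> R) :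
  measurable_fun setT f -> PO.-integrable setT (EFin \o (f \o X 0%N)) ->
  path_law.-integrable setT (EFin \o g) ->
  (forall x, 0 <= f x) -> (forall x, 0 <= g x) ->
  path_law.-integrable setT (EFin \o (fun x => f (x 0%N) * g (shift x))) /\
  \int[path_law]_x (f (x 0%N) * g (shift x)) =
  (\int[PO]_w f (X 0%N w)) * \int[path_law]_x g x.
Proof.
move=> mf fi gi f0 g0; have mg := integrable_measurable gi.
have E := integral_head_tail_prod mf mg f0 g0.
have Ef : (\int[PO]_w (f (X 0%N w))%:E = (\int[PO]_w f (X 0%N w))%:E)%E.
  by rewrite fineK//; exact: (integrable_fin_num measurableT fi).
have Eg : (\int[path_law]_w (g w)%:E = (\int[path_law]_w g w)%:E)%E.
  by rewrite fineK//; exact: (integrable_fin_num measurableT gi).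
rewrite Ef Eg -EFinM in E; split; last by rewrite /Rintegral E.
apply/integrableP; split.
  apply/measurable_EFinP/measurable_funM.
    exact: measurableT_comp mf (measurable_coord 0).
  exact: measurableT_comp mg (@measurable_shift _ T).
rewrite (eq_integral (fun x : seq_space T => (f (x 0%N) * g (shift x))%:E)) ?E ?ltry//.
by move=> x _ /=; rewrite ger0_norm// mulr_ge0.
Qed.

Lemma Rintegral_shift (g : seq_space T -> R) :
  path_law.-integrable setT (EFin \o g) -> (forall x, 0 <= g x) ->
  path_law.-integrable setT (EFin \o (fun x => g (shift x))) /\
  \int[path_law]_x g (shift x) = \int[path_law]_x g x.
Proof.
move=> gi g0.
have [h1 h2] := @Rintegral_head_tail (fun=> 1) g (measurable_cst _)
  (integrable_const PO 1) gi (fun=> ler01) g0.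
rewrite (Rintegral_const PO 1) mul1r in h2; split.
  by move: h1; congr (_.-integrable _ _); apply/funext => x /=; rewrite mul1r.
by rewrite -h2; apply: eq_Rintegral => x _; rewrite mul1r.
Qed.

(** * The strong law of large numbers *)

Section maximal.
Variable h : T -> R.
Hypothesis mh : measurable_fun setT h.
Hypothesis ih : PO.-integrable setT (EFin \o (h \o X 0%N)).

(** The largest of 0 and the first [n] partial sums of [h] along [x], computed
    from the first term and the shifted sequence so that comparing the path with
    its shift, which has the same law, is immediate. *)
Fixpoint running_max n (x : seq_space T) : R :=
  if n is m.+1 then Num.max 0 (h (x 0%N) + running_max m (shift x)) else 0.

Lemma running_max_ge0 n x : 0 <= running_max n x.
Proof. by case: n => [|n]//=; rewrite le_max lexx. Qed.

Lemma running_max_leS n x : running_max n x <= running_max n.+1 x.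
Proof.
elim: n x => [|n IHn] x; first exact: running_max_ge0.
by rewrite [in leRHS]/= ge_max/= le_max lexx/= le_max lerD2l IHn orbT.
Qed.

Lemma running_max_le m n x : (m <= n)%N -> running_max m x <= running_max n x.
Proof.
move=> /subnKC <-; elim: (n - m)%N => [|k IHk]; first by rewrite addn0.
by rewrite addnS (le_trans IHk)// running_max_leS.
Qed.

Lemma sum_le_running_max n (x : seq_space T) : \sum_(j < n) h (x j) <= running_max n x.
Proof.
elim: n x => [|n IHn] x; first by rewrite big_ord0.
by rewrite big_ord_recl/= le_max lerD2l (IHn (shift x)) orbT.
Qed.

Lemma measurable_running_max n : measurable_fun setT (running_max n).
Proof.
elim: n => [|n IHn]; first exact: measurable_cst.
apply: measurable_maxr => //; apply: measurable_funD.
  exact: measurableT_comp mh (measurable_coord 0).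
exact: measurableT_comp IHn (@measurable_shift _ T).
Qed.

Lemma integrable_head :
  path_law.-integrable setT (EFin \o (fun x => `|h (x 0%N)|)).
Proof.
have [] := @Rintegral_head_tail (fun t => `|h t|) (fun=> 1)
  (measurableT_comp (@normr_measurable R setT) mh)
  (@integrable_norm _ _ _ PO setT (h \o X 0%N) ih)
  (integrable_const path_law 1) (fun=> normr_ge0 _) (fun=> ler01).
by move=> + _; congr (_.-integrable _ _); apply/funext => x /=; rewrite mulr1.
Qed.

Lemma integrable_running_max n : path_law.-integrable setT (EFin \o running_max n).
Proof.
elim: n => [|n IHn]; first exact: (integrable_const path_law 0).
have [h1 _] := Rintegral_shift IHn (running_max_ge0 n).
apply: (@integrable_dominated _ _ _ path_law (running_max n.+1)
  (fun x => `|h (x 0%N)| + running_max n (shift x))).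
- exact: measurable_running_max.
- exact: integrable_add integrable_head h1.
- move=> x /=; rewrite ger0_norm ?le_max ?lexx// ge_max.
  by rewrite addr_ge0 ?running_max_ge0//= lerD2r ler_norm.
Qed.

(** The event that the partial sums of [h] are not bounded above. A finite number
    of terms does not affect it, whence its invariance under the shift. *)
Definition escape : set (seq_space T) :=
  [set x | forall k : nat, exists n, k%:R < running_max n x].

Lemma measurable_escape : measurable escape.
Proof.
rewrite (_ : escape = \bigcap_k \bigcup_n running_max n @^-1` `]k%:R, +oo[%classic).
  apply: bigcapT_measurable => k; apply: bigcupT_measurable => n.
  by rewrite -[X in measurable X]setTI; exact: measurable_running_max.
apply/seteqP; split=> x /= hx k.
  by move=> _; have [n kn] := hx k; exists n => //=; rewrite in_itv/= kn.
by have [n _ /=] := hx k I; rewrite in_itv/= andbT => kn; exists n.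
Qed.

Lemma escape_shift x : escape (shift x) <-> escape x.
Proof.
split=> hx k.
  have [n kn] := hx `|Num.ceil (k%:R - h (x 0%N))|%N.
  exists n.+1; rewrite /= lt_max -ltrBlDl; apply/orP; right.
  apply: le_lt_trans kn; apply: le_trans (ceil_ge _) _.
  by rewrite natr_absz ler_int ler_norm.
have [n kn] := hx `|Num.ceil (k%:R + h (x 0%N))|%N.
have kh : k%:R + h (x 0%N) <= `|Num.ceil (k%:R + h (x 0%N))|%:R.
  by apply: le_trans (ceil_ge _) _; rewrite natr_absz ler_int ler_norm.
have {kn} := lt_le_trans kn (running_max_leS n x).
rewrite /= lt_max => /orP[h0|kn].
  by exfalso; move: h0; rewrite ltNge ler0n.
by exists n; rewrite -(ltrD2l (h (x 0%N))) addrC (le_lt_trans kh).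
Qed.

Lemma indic_escape_shift x : \1_escape (shift x) = \1_escape x :> R.
Proof.
rewrite !indicE; have [xE|xE] := boolP (x \in escape).
  by rewrite mem_set//; apply/escape_shift; rewrite inE in xE.
by rewrite memNset// => /escape_shift/mem_set; apply/negP.
Qed.

Lemma integrable_indic_mul (f : seq_space T -> R) :
  path_law.-integrable setT (EFin \o f) ->
  path_law.-integrable setT (EFin \o (fun x => \1_escape x * f x)).
Proof.
move=> fi; apply: (@integrable_dominated _ _ _ _ _ (fun x => `|f x|)).
- apply: measurable_funM; last exact: integrable_measurable fi.
  exact: measurable_indic measurable_escape.
- exact: integrable_norm.
- by move=> x; rewrite normrM indicE; case: (x \in escape) => /=;
    rewrite ?normr1 ?mul1r// normr0 mul0r.
Qed.

(** A maximal inequality in the style of Garsia. On the escape event the increment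
    [running_max n.+1 x - running_max n (shift x)], which equals
    [max(- running_max n (shift x), h (x 0))], has nonnegative integral because
    the shift preserves the law and the event, and because [running_max]
    increases with [n]. It converges to [h (x 0)] on the event, which therefore
    has nonnegative integral there. But the event is determined by the shifted
    sequence, hence independent of [h (x 0)], whose mean is negative; so the
    event is null. *)
Lemma escape_null : \int[PO]_w h (X 0%N w) < 0 -> path_law escape = 0%E.
Proof.
move=> h0.
pose D n (x : seq_space T) := Num.max (- running_max n (shift x)) (h (x 0%N)).
have ish n : path_law.-integrable setT (EFin \o (fun x => running_max n (shift x))).
  by have [] := Rintegral_shift (integrable_running_max n) (running_max_ge0 n).
have mhead : measurable_fun setT (fun x : seq_space T => h (x 0%N)).
  exact: measurableT_comp mh (measurable_coord 0).
have mD n : measurable_fun setT (D n).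
  apply: measurable_maxr => //; apply: measurableT_comp => //.
  exact: integrable_measurable (ish n).
have D_le n x : `|D n x| <= `|h (x 0%N)|.
  rewrite /D maxEle; case: ifPn => //; rewrite -ltNge => hM.
  have := running_max_ge0 n (shift x); have := ler_norm (- h (x 0%N)).
  by rewrite normrN => h1 h2; rewrite ler0_norm; lra.
have iD n : path_law.-integrable setT (EFin \o D n).
  exact: (@integrable_dominated _ _ _ path_law (D n) (fun x => `|h (x 0%N)|)
    (mD n) integrable_head (D_le n)).
have DE n x : running_max n.+1 x = running_max n (shift x) + D n x.
  by rewrite /D addr_maxr subrr [_ + h _]addrC.
have D_ge0 n : 0 <= \int[path_law]_x (\1_escape x * D n x).
  have -> : \int[path_law]_x (\1_escape x * D n x) =
      \int[path_law]_x (\1_escape x * running_max n.+1 x) -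
      \int[path_law]_x (\1_escape x * running_max n (shift x)).
    rewrite -RintegralB//; last 2 first.
    - exact: integrable_indic_mul (integrable_running_max n.+1).
    - exact: integrable_indic_mul (ish n).
    by apply: eq_Rintegral => x _; rewrite DE; ring.
  have -> : \int[path_law]_x (\1_escape x * running_max n (shift x)) =
      \int[path_law]_x (\1_escape x * running_max n x).
    rewrite -(Rintegral_shift (integrable_indic_mul (integrable_running_max n)) _).2.
      by apply: eq_Rintegral => x _; rewrite indic_escape_shift.
    by move=> x; rewrite mulr_ge0// running_max_ge0.
  rewrite subr_ge0; apply: le_Rintegral => //.
  - exact: integrable_indic_mul (integrable_running_max n).
  - exact: integrable_indic_mul (integrable_running_max n.+1).
  - by move=> x _; rewrite ler_wpM2l// running_max_leS.
have Dcvg : (fun n => \int[path_law]_x (\1_escape x * D n x)) @ \oo -->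
    \int[path_law]_x (\1_escape x * h (x 0%N)).
  apply: (@Rintegral_dominated_cvg _ _ _ path_law
    (fun n x => \1_escape x * D n x) _ (fun x => `|h (x 0%N)|)).
  - move=> n; apply: measurable_funM => //.
    exact: measurable_indic measurable_escape.
  - by apply: measurable_funM => //; exact: measurable_indic measurable_escape.
  - exact: integrable_head.
  - apply: aeW => x; have [xE|xE] := pselect (escape x); last first.
      apply: cvg_near_cst; apply: nearW => n.
      by rewrite indicE memNset// !mul0r.
    apply: cvg_near_cst.
    have [N hN] := (escape_shift x).2 xE `|Num.ceil (- h (x 0%N))|%N.
    exists N => // n /= Nn; congr (_ * _); apply/max_idPr; rewrite lerNl.
    apply: le_trans (running_max_le (shift x) Nn); apply: ltW.
    apply: le_lt_trans hN; apply: le_trans (ceil_ge _) _.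
    by rewrite natr_absz ler_int ler_norm.
  - apply: aeW => x n; rewrite normrM indicE.
    by case: (x \in escape) => /=; rewrite ?normr1 ?mul1r// normr0 mul0r.
have lim_ge0 : 0 <= \int[path_law]_x (\1_escape x * h (x 0%N)).
  rewrite -(cvg_lim _ Dcvg)//; apply: limr_ge; first exact: cvgP Dcvg.
  exact: nearW.
have ie : path_law.-integrable setT (EFin \o (\1_escape : seq_space T -> R)).
  exact: integrable_indic measurable_escape.
(* Independence is available for nonnegative functions; split [h]. *)
pose hp t := Num.max 0 (h t); pose hn t := Num.max 0 (- h t).
have hpn t : h t = hp t - hn t.
  by rewrite /hp /hn !maxEle; case: ifPn; case: ifPn; rewrite -?ltNge; lra.
have mhp : measurable_fun setT hp by exact: measurable_maxr.
have mhn : measurable_fun setT hn.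
  by apply: measurable_maxr => //; exact: measurableT_comp.
have ihp : PO.-integrable setT (EFin \o (hp \o X 0%N)).
  apply: (@integrable_dominated _ _ _ _ _ (fun w => `|(h \o X 0%N) w|)).
  - exact: measurableT_comp mhp _.
  - exact: integrable_norm.
  - by move=> w /=; rewrite /hp maxEle; case: ifPn; rewrite ?normr0.
have ihn : PO.-integrable setT (EFin \o (hn \o X 0%N)).
  apply: (@integrable_dominated _ _ _ _ _ (fun w => `|(h \o X 0%N) w|)).
  - exact: measurableT_comp mhn _.
  - exact: integrable_norm.
  - by move=> w /=; rewrite /hn maxEle; case: ifPn; rewrite ?normr0// normrN.
have hp0 t : 0 <= hp t by rewrite le_max lexx.
have hn0 t : 0 <= hn t by rewrite le_max lexx.
have e0 x : 0 <= \1_escape x :> R by [].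
have [ip Ep] := Rintegral_head_tail mhp ihp ie hp0 e0.
have [in_ En] := Rintegral_head_tail mhn ihn ie hn0 e0.
have : \int[path_law]_x (\1_escape x * h (x 0%N)) =
    (\int[PO]_w h (X 0%N w)) * \int[path_law]_x \1_escape x.
  transitivity (\int[path_law]_x (hp (x 0%N) * \1_escape (shift x) -
    hn (x 0%N) * \1_escape (shift x))).
    by apply: eq_Rintegral => x _; rewrite indic_escape_shift hpn; ring.
  rewrite RintegralB// Ep En -mulrBl; congr (_ * _).
  by rewrite -RintegralB//; apply: eq_Rintegral => w _; rewrite /= -hpn.
rewrite Rintegral_indicator; last exact: measurable_escape.
move=> E; move: lim_ge0; rewrite E nmulr_rge0// => p0.
rewrite -[LHS]fineK; last by rewrite fin_num_measure//; exact: measurable_escape.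
by congr EFin; apply/le_anti; rewrite p0 fine_ge0.
Qed.

Lemma partial_sums_bounded : \int[PO]_w h (X 0%N w) < 0 ->
  {ae PO, forall w, exists K : nat, forall n, \sum_(j < n) h (X j w) <= K%:R}.
Proof.
move=> /escape_null E0; exists (sample_path @^-1` escape); split.
- rewrite -[X in measurable X]setTI; apply: measurable_sample_path => //.
  exact: measurable_escape.
- exact: E0.
- move=> w /= hw k; apply: contrapT => hk; apply: hw; exists k => n.
  apply: le_trans (sum_le_running_max n (sample_path w)) _.
  by rewrite leNgt; apply/negP => kn; apply: hk; exists n.
Qed.
End maximal.

(** One half of the strong law, for integrable summands; the other half is the same
    statement for [- h]. Subtracting a constant between the mean and [c] makes the
    mean negative, so that the centered sums are bounded above. *)
Lemma lln_upper (h : T -> R) (c : R) : measurable_fun setT h ->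
  PO.-integrable setT (EFin \o (h \o X 0%N)) ->
  \int[PO]_w h (X 0%N w) < c ->
  {ae PO, forall w, \forall n \near \oo, n%:R^-1 * \sum_(j < n) h (X j w) <= c}.
Proof.
move=> mh ih hc; set m := \int[PO]_w _ in hc.
(* The bounded excess is absorbed by the gap between [c'] and [c]. *)
pose c' := (m + c) / 2; have mc : m < c' by rewrite /c'; lra.
have c'c : c' < c by rewrite /c'; lra.
have [|||] := @partial_sums_bounded (fun t => h t - c').
- by apply: measurable_funB.
- exact: integrable_sub ih (integrable_const PO c').
- rewrite RintegralB//; last exact: (integrable_const PO c').
  by rewrite (Rintegral_const PO) subr_lt0.
move=> N [mN N0 sN]; exists N; split => //; apply: subset_trans sN => w /= hw [K hK].
apply: hw; near=> n.
have n0 : (0 < n)%N by near: n; exact: nbhs_infty_gt.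
have nR : (0 : R) < n%:R by rewrite ltr0n.
rewrite mulrC ler_pdivrMr//.
have := hK n; rewrite sumrB sumr_const card_ord => h1.
have : K%:R <= (c - c') * n%:R.
  rewrite mulrC -ler_pdivrMr ?subr_gt0//; near: n; exact: nbhs_infty_ger.
by move: h1; rewrite -[c' *+ n]mulr_natr; lra.
Unshelve. all: by end_near. Qed.
End iid_sequence.

(** * Completion of the law of a random element *)

Lemma measurable_pospart d (T : measurableType d) (R : realType) (f : T -> R) :
  measurable_fun setT f -> measurable_fun setT (fun x => Num.max 0 (f x)).
Proof. by move=> mf; exact: measurable_maxr. Qed.

Lemma measurable_negpart d (T : measurableType d) (R : realType) (f : T -> R) :
  measurable_fun setT f -> measurable_fun setT (fun x => Num.max 0 (- f x)).
Proof. by move=> mf; apply: measurable_maxr => //; exact: measurableT_comp. Qed.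

Lemma integrable_ae_eq d (T : measurableType d) (R : realType)
    (P : probability T R) (f g : T -> R) :
  measurable_fun setT g -> P.-integrable setT (EFin \o f) ->
  {ae P, forall x, f x = g x} ->
  P.-integrable setT (EFin \o g) /\ \int[P]_x g x = \int[P]_x f x.
Proof.
move=> mg fi fg; have mf := integrable_measurable fi.
have /measurable_EFinP mge := mg; have /measurable_EFinP mfe := mf.
have ig : P.-integrable setT (EFin \o g).
  apply/integrableP; split => //.
  have /integrableP[_] := fi; rewrite (ae_eq_integral (abse \o (EFin \o g)))//.
  - exact: measurableT_comp.
  - exact: measurableT_comp.
  - by apply: filterS fg => x /= -> _.
split => //; congr fine; apply: ae_eq_integral => //.
by apply: filterS fg => x /= -> _.
Qed.

Section completion.
Context (R : realType) (H : completeNormedModType R).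
Context d (Om : measurableType d) (PO : probability Om R).
Variable xi : {mfun Om >-> borel_type H}.

Let P : probability (law_type PO xi) R := law PO xi.

Lemma law_measurable (E : set (borel_type H)) : measurable E ->
  measurable (E : set (law_type PO xi)).
Proof. exact: caratheodory_measurable_mu_ext. Qed.

Lemma law_measurable_id :
  measurable_fun setT (fun x : law_type PO xi => x : borel_type H).
Proof. by move=> _ E mE; rewrite setTI; exact: law_measurable. Qed.

(** The outer measure is an infimum over countable Borel covers; intersecting
    nearly optimal covers gives a Borel superset of the same measure. *)
Lemma law_borel_hull (E : set (law_type PO xi)) : measurable E ->
  exists B : set (borel_type H), [/\ measurable B, E `<=` B & P B = P E].
Proof.
move=> mE.
have PEfin : P E \is a fin_num by rewrite fin_num_measure.
have cover k : exists F : nat -> set (borel_type H),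
    [/\ forall i, measurable (F i), E `<=` \bigcup_i F i &
        (P (\bigcup_i F i) < P E + k.+1%:R^-1%:E)%E].
  have k0 : (0 < k.+1%:R^-1 :> R) by rewrite invr_gt0.
  have [_ [F [mF EF] <-] lt] := lb_ereal_inf_adherent k0 PEfin.
  exists F; split => //; apply: le_lt_trans lt.
  apply: le_trans (outer_measure_sigma_subadditive _ F) _.
  apply: lee_nneseries => // i _.
  by rewrite -(measurable_mu_extE (distribution PO xi) (mF i)).
pose F k := projT1 (cid (cover k)).
have mF k i : measurable (F k i) by rewrite /F; case: cid => /= ? [].
have EF k : E `<=` \bigcup_i F k i by rewrite /F; case: cid => /= ? [].
have ltF k : (P (\bigcup_i F k i) < P E + k.+1%:R^-1%:E)%E.
  by rewrite /F; case: cid => /= ? [].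
pose B := \bigcap_k \bigcup_i F k i.
have mB : measurable (B : set (borel_type H)).
  by apply: bigcapT_measurable => k; apply: bigcupT_measurable.
have EB : E `<=` B by move=> x Ex k _; exact: EF.
have mB' := law_measurable mB.
exists B; split => //.
apply/eqP; rewrite eq_le; apply/andP; split; last by apply: le_measure; rewrite ?inE.
apply/lee_addgt0Pr => e e0.
near \oo => k.
apply: le_trans (_ : (P (\bigcup_i F k i) <= _)%E).
  apply: le_measure; rewrite ?inE//.
    by apply: law_measurable; apply: bigcupT_measurable.
  exact: bigcap_inf.
apply: le_trans (ltW (ltF k)) _; rewrite leeD2l// lee_fin ltW//.
by near: k; exact: near_infty_natSinv_lt (PosNum e0).
Unshelve. all: by end_near. Qed.

Lemma law_borel_version (E : set (law_type PO xi)) : measurable E ->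
  exists2 B : set (borel_type H), measurable B & {ae P, forall x, E x <-> B x}.
Proof.
move=> mE; have [B [mB EB PBE]] := law_borel_hull mE.
have mB' := law_measurable mB.
exists B => //; exists (B `\` E); split.
- exact: measurableD.
- rewrite measureD//; last by rewrite ltey_eq fin_num_measure.
  rewrite setIidr//; transitivity (P E - P E)%E; first by congr (_ - _)%E.
  by rewrite subee// fin_num_measure.
- move=> x /= h; split.
    apply: contrapT => nBx; apply: h; split=> [/EB//|//].
  by move=> Ex; apply: h; split=> // _; exact: EB.
Qed.

(** A nonnegative function is the supremum over rational [q >= 0] of [q] times the
    indicator of [{h > q}]. Replacing these countably many sets by Borel versions
    changes the supremum on a null set only. *)
Lemma borel_version_ge0 (h : law_type PO xi -> R) :
  measurable_fun setT h -> (forall x, 0 <= h x) ->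
  exists2 g : borel_type H -> R, measurable_fun setT g & {ae P, forall x, h x = g x}.
Proof.
move=> mh h0.
pose q k : R := if unpickle k is Some r then `|ratr (r : rat)| else 0.
have mhq k : measurable [set x : law_type PO xi | q k < h x].
  rewrite -[X in measurable X]setTI.
  rewrite (_ : [set x | _] = h @^-1` `]q k, +oo[%classic); first exact: mh.
  by apply/seteqP; split=> w /=; rewrite in_itv/= andbT.
have hB k := law_borel_version (mhq k).
pose B k := projT1 (cid2 (hB k)).
have mB k : measurable (B k) by rewrite /B; case: cid2.
have aeB k : {ae P, forall x, q k < h x <-> B k x} by rewrite /B; case: cid2.
pose f (x : borel_type H) := esups (fun k => (q k * \1_(B k) x)%:E) 0%N.
have mf : measurable_fun setT f.
  apply: measurable_fun_esups => k; apply/measurable_EFinP.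
  by apply: measurable_funM => //; exact: measurable_indic.
exists (fine \o f); first exact: measurableT_comp.
have /ae_foralln := aeB; apply: filterS => x Bx.
suff fE : f x = (h x)%:E by rewrite /= fE.
apply/eqP; rewrite eq_le; apply/andP; split.
  apply: ge_ereal_sup => _ [k _ <-]; rewrite lee_fin indicE.
  have [|] := boolP (x \in B k); first by rewrite inE mulr1 => /Bx/ltW.
  by rewrite mulr0.
have ub k : ((q k * \1_(B k) x)%:E <= f x)%E.
  by apply: ereal_sup_ubound; exists k.
apply/lee_addgt0Pr => e e0.
have [hx0|hx0] := eqVneq (h x) 0.
  rewrite hx0; apply: le_trans (_ : (f x <= _)%E); last first.
    by rewrite leeDl// lee_fin ltW.
  by apply: le_trans (ub 0%N); rewrite lee_fin mulr_ge0// /q; case: unpickle.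
have hgt : Num.max 0 (h x - e) < h x.
  by rewrite gt_max lt_neqAle eq_sym hx0 h0/= ltrBlDr ltrDl.
have [r] := rat_in_itvoo hgt.
rewrite in_itv/= gt_max => /andP[/andP[r0 hr] rh].
have qr : q (pickle r) = ratr r by rewrite /q pickleK ger0_norm// ltW.
have Br : B (pickle r) x by apply/Bx; rewrite qr.
apply: le_trans (_ : ((ratr r)%:E + e%:E <= _)%E).
  by rewrite -EFinD lee_fin -lerBlDr ltW.
apply: leeD => //; apply: le_trans (ub (pickle r)).
by rewrite qr indicE mem_set// mulr1.
Qed.

Lemma borel_version (h : law_type PO xi -> R) : measurable_fun setT h ->
  exists2 g : borel_type H -> R, measurable_fun setT g & {ae P, forall x, h x = g x}.
Proof.
move=> mh.
have [||gp mgp gpE] := @borel_version_ge0 (fun x => Num.max 0 (h x)).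
- exact: measurable_pospart.
- by move=> x; rewrite le_max lexx.
have [||gn mgn gnE] := @borel_version_ge0 (fun x => Num.max 0 (- h x)).
- exact: measurable_negpart.
- by move=> x; rewrite le_max lexx.
exists (fun x => gp x - gn x); first exact: measurable_funB.
apply: filterS2 gpE gnE => x <- <-; rewrite !maxEle.
by case: ifPn; case: ifPn; rewrite -?ltNge; lra.
Qed.

Lemma ae_law_sample (X : {mfun Om >-> borel_type H}) (Q : H -> Prop) :
  same_law PO X xi -> {ae P, forall x, Q x} -> {ae PO, forall w, Q (X w)}.
Proof.
move=> Xxi [N [mN N0 sN]].
have [B [mB NB PB]] := law_borel_hull mN.
exists (X @^-1` B); split.
- by rewrite -[X in measurable X]setTI; exact: measurable_funPT.
- by rewrite Xxi// -law_borel// -N0 -PB.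
- by move=> w /= h; apply: NB; apply: sN.
Qed.

(** The identity, as a map from the completed space to the Borel space; it transports
    integrals from the one to the other. *)
Definition law_id (x : law_type PO xi) : borel_type H := x.

HB.instance Definition _ :=
  isMeasurableFun.Build _ _ _ _ law_id law_measurable_id.

Lemma integral_law_borel (X : {mfun Om >-> borel_type H}) (g : borel_type H -> R) :
  same_law PO X xi -> measurable_fun setT g ->
  P.-integrable setT (EFin \o (g \o law_id)) ->
  PO.-integrable setT (EFin \o (g \o X)) /\
  \int[PO]_w g (X w) = \int[P]_x g (law_id x).
Proof.
move=> Xxi mg ig.
have eqm (A : set (borel_type H)) : measurable A -> A `<=` setT ->
    distribution PO X A = distribution P law_id A.
  by move=> mA _; rewrite /distribution /pushforward Xxi// -law_borel.
have mge : measurable_fun setT (EFin \o g) by exact/measurable_EFinP.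
have igX : PO.-integrable setT (EFin \o (g \o X)).
  apply/integrableP; split.
    by apply/measurable_EFinP; exact: measurableT_comp.
  rewrite -(@ge0_integral_distribution _ _ _ _ _ PO X (fun y => `|(g y)%:E|%E))//;
    last exact: measurableT_comp.
  rewrite (eq_measure_integral (distribution P law_id))//.
  rewrite ge0_integral_distribution//; last exact: measurableT_comp.
  by have /integrableP[_] := ig.
split => //; rewrite /Rintegral.
rewrite -(@integral_distribution _ _ _ _ _ PO X (EFin \o g))//.
rewrite (eq_measure_integral (distribution P law_id))//.
by rewrite integral_distribution.
Qed.
End completion.

Section sampling.
Context (R : realType) (H : completeNormedModType R).
Context d (Om : measurableType d) (PO : probability Om R).
Variables (xi : {mfun Om >-> borel_type H}) (X : nat -> {mfun Om >-> borel_type H}).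
Hypothesis indep : independent_seq PO X.
Hypothesis same : forall j, same_law PO (X j) xi.

Let P : probability (law_type PO xi) R := law PO xi.

(** The integrand is measurable for the completed sigma-field only, and composed with
    an observation it need not be a random variable. It is replaced by a Borel
    version, which agrees with it at all observations almost surely. *)
Lemma sample_average_upper (h : law_type PO xi -> R) (c : R) :
  P.-integrable setT (EFin \o h) -> \int[P]_x h x < c ->
  {ae PO, forall w, \forall n \near \oo, n%:R^-1 * \sum_(j < n) h (X j w) <= c}.
Proof.
move=> ih hc.
have mh := integrable_measurable ih.
have [g mg hg] := borel_version mh.
have mgl : measurable_fun setT (g \o @law_id _ _ _ _ PO xi).
  exact: measurableT_comp.
have [ig Ig] := integrable_ae_eq mgl ih hg.
have [igX IgX] := integral_law_borel (same 0%N) mg ig.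
have := @lln_upper _ _ _ _ _ PO X indep _ g c mg igX.
rewrite IgX; have -> : \int[P]_x g (law_id x) = \int[P]_x h x by exact: Ig.
move=> /(_ _ hc) lln.
have hgX : {ae PO, forall w, forall j, h (X j w) = g (X j w)}.
  apply: ae_foralln => j; exact: (ae_law_sample (same j) hg).
apply: filterS2 (lln _) hgX => [w lw hw|].
  have E n : \sum_(j < n) h (X j w) = \sum_(j < n) g (X j w).
    by apply: eq_bigr => j _; exact: hw.
  by apply: filterS lw => n; rewrite E.
by move=> j E mE; rewrite !same.
Qed.

Lemma ae_sample (Q : H -> Prop) : {ae P, forall x, Q x} ->
  {ae PO, forall w, forall j, Q (X j w)}.
Proof. by move=> hQ; apply: ae_foralln => j; exact: ae_law_sample (same j) hQ. Qed.
End sampling.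

Section ae_integral.
Context d (T : measurableType d) (R : realType) (P : probability T R).

Lemma integrable_ae_dominated (f c : T -> R) :
  measurable_fun setT f -> P.-integrable setT (EFin \o c) ->
  {ae P, forall x, `|f x| <= c x} -> P.-integrable setT (EFin \o f).
Proof.
move=> mf ic fc; have mc := integrable_measurable ic.
have mm : measurable_fun setT (fun x => Num.min `|c x| (Num.max (- `|c x|) (f x))).
  apply: measurable_minr; first exact: measurableT_comp.
  by apply: measurable_maxr => //; do 2 apply: measurableT_comp => //.
apply: (integrable_ae_eq mf (f := fun x => Num.min `|c x| (Num.max (- `|c x|) (f x))) _ _).1.
  apply: (@integrable_dominated _ _ _ _ _ (fun x => `|c x|)) => //.
    exact: integrable_norm.
  move=> x; rewrite ler_norml le_min ge_min lexx andbT/= le_max lexx/= andbT.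
  by have := normr_ge0 (c x); lra.
apply: filterS fc => x fx.
have := ler_norm (c x); have := le_trans (ler_norm (- f x)) _; rewrite normrN.
move=> /(_ _ fx) h1 h2; have h3 := le_trans (ler_norm _) fx.
by rewrite (max_idPr _) ?(min_idPr _)//; lra.
Qed.

Lemma le_Rintegral_ae (f g : T -> R) :
  P.-integrable setT (EFin \o f) -> P.-integrable setT (EFin \o g) ->
  {ae P, forall x, f x <= g x} -> \int[P]_x f x <= \int[P]_x g x.
Proof.
move=> fi gi fg; have mf := integrable_measurable fi; have mg := integrable_measurable gi.
have gE : {ae P, forall x, g x = (f \max g) x}.
  by apply: filterS fg => x fgx; apply/esym/max_idPr.
have [im <-] := integrable_ae_eq (measurable_maxr mf mg) gi gE.
by apply: le_Rintegral => // x _; rewrite le_max lexx.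
Qed.
End ae_integral.

(** * A locally uniform law of large numbers *)

Lemma exists_invn_lt (R : realType) (e : R) : 0 < e ->
  exists k : nat, k.+1%:R^-1 < e.
Proof.
move=> e0; near \oo => k; exists k; near: k.
exact: near_infty_natSinv_lt (PosNum e0).
Unshelve. all: by end_near. Qed.

Section uniform_lln.
Context (R : realType) dS (S : measurableType dS) (P : probability S R).
Context dO (Om : measurableType dO) (PO : probability Om R) (smp : nat -> Om -> S).
Hypothesis lln : forall (h : S -> R) (c : R), P.-integrable setT (EFin \o h) ->
  \int[P]_x h x < c ->
  {ae PO, forall w, \forall n \near \oo, n%:R^-1 * \sum_(j < n) h (smp j w) <= c}.
Hypothesis ae_smp : forall Q : S -> Prop, {ae P, forall x, Q x} ->
  {ae PO, forall w, forall j, Q (smp j w)}.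

Context (V : normedModType R) (A : set V) (D : nat -> V) (h : S -> V -> R).
Hypothesis AD : forall i, A (D i).
Hypothesis D_dense : forall z (r : R), A z -> 0 < r -> exists i, `|D i - z| < r.
Hypothesis h_cont : {ae P, forall x, continuous (h x)}.
Hypothesis h_int : forall z, A z -> P.-integrable setT (EFin \o h^~ z).
Hypothesis h_dom : forall z, A z -> exists (rho : R) (c : S -> R),
  [/\ 0 < rho, P.-integrable setT (EFin \o c) &
      forall z', A z' -> `|z' - z| < rho -> {ae P, forall x, `|h x z'| <= c x}].

(** The supremum of [`|h x z' - h x z|] over [z'] near [z] is computed along a
    dense sequence, which makes it measurable in [x]. It tends to 0 as the radius
    shrinks because [h x] is continuous, and it is dominated by an integrable
    function, so its integral tends to 0 as well. *)
Lemma oscillation_small z (e : R) : A z -> 0 < e -> exists (r : R) (c : S -> R),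
  [/\ 0 < r, P.-integrable setT (EFin \o c), \int[P]_x c x < e &
      {ae P, forall x, forall z', A z' -> `|z' - z| < r -> `|h x z' - h x z| <= c x}].
Proof.
move=> Az e0; have [rho [c [rho0 ic hc]]] := h_dom Az.
pose u m i x := if `|D i - z| < m.+1%:R^-1 then `|h x (D i) - h x z| else 0.
(* Domination holds within [rho] only, hence the offset [m0]. *)
have [m0 m0rho] := exists_invn_lt rho0.
pose G m x := esups (fun i => (u (m0 + m)%N i x)%:E) 0%N.
pose g m x := fine (G m x).
have mu m i : measurable_fun setT (u m i).
  rewrite /u; case: (_ < _); last exact: measurable_cst.
  apply: measurableT_comp => //; apply: measurable_funB.
    exact: integrable_measurable (h_int (AD i)).
  exact: integrable_measurable (h_int Az).
have mG m : measurable_fun setT (G m).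
  by apply: measurable_fun_esups => i; exact/measurable_EFinP.
have mg m : measurable_fun setT (g m) by exact: measurableT_comp.
have u0 m i x : 0 <= u m i x by rewrite /u; case: ifP.
have uG m i x : ((u (m0 + m)%N i x)%:E <= G m x)%E.
  by apply: ereal_sup_ubound; exists i.
have Gub m x b : (forall i, u (m0 + m)%N i x <= b) -> (G m x <= b%:E)%E.
  by move=> ub; apply: ge_ereal_sup => _ [i _ <-]; rewrite lee_fin.
have G0 m x : (0 <= G m x)%E by apply: le_trans (uG m 0%N x); rewrite lee_fin.
have hm m : (m0 + m).+1%:R^-1 < rho.
  by apply: le_lt_trans m0rho; rewrite lef_pV2 ?posrE// ler_nat ltnS leq_addr.
have bnd : {ae P, forall x, forall m i, u (m0 + m)%N i x <= c x + c x}.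
  have h1 : {ae P, forall x, `|h x z| <= c x} by apply: hc => //; rewrite subrr normr0.
  have h2 : {ae P, forall x, forall i, `|D i - z| < rho -> `|h x (D i)| <= c x}.
    apply: ae_foralln => i; have [ir|ir] := ltP `|D i - z| rho.
      by apply: filterS (hc _ (AD i) ir) => x.
    by apply: aeW => x.
  apply: filterS2 h1 h2 => x hx hD m i; rewrite /u; case: ifPn => im.
    apply: le_trans (ler_normB _ _) _; apply: lerD => //.
    by apply: hD; exact: lt_trans (hm m).
  by have := le_trans (normr_ge0 _) hx; lra.
have fG m x b : (forall i, u (m0 + m)%N i x <= b) -> G m x = (g m x)%:E.
  move=> ub; rewrite fineK// ge0_fin_numE// (le_lt_trans (Gub _ _ _ ub))//.
  exact: ltry.
have g_le : {ae P, forall x, forall m, `|g m x| <= c x + c x}.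
  apply: filterS bnd => x ub m; rewrite ger0_norm ?fine_ge0//.
  by rewrite -lee_fin -(fG _ _ _ (ub m)); exact: Gub.
have gcvg : {ae P, forall x, g^~ x @ \oo --> 0}.
  apply: filterS2 bnd h_cont => x ub cx; apply/cvgrPdist_le => b b0.
  have := cx z; move=> /cvgrPdist_le /(_ _ b0) /nbhs_ballP[dl /= dl0 hdl].
  near=> m.
  rewrite sub0r normrN ger0_norm ?fine_ge0//.
  rewrite -lee_fin -(fG _ _ _ (ub m)); apply: Gub => i.
  rewrite /u; case: ifPn => im; last exact: ltW.
  rewrite distrC; apply: hdl; rewrite -ball_normE/= distrC.
  apply: lt_trans im _; apply: le_lt_trans (_ : m.+1%:R^-1 < _).
    by rewrite lef_pV2 ?posrE// ler_nat ltnS leq_addl.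
  by near: m; exact: near_infty_natSinv_lt (PosNum dl0).
have Icvg : (fun m => \int[P]_x g m x) @ \oo --> \int[P]_x (0 : R).
  apply: (@Rintegral_dominated_cvg _ _ _ P g (fun=> 0) (fun x => c x + c x)) => //.
  exact: integrable_add.
rewrite Rintegral_const in Icvg.
have [m Im] : exists m, \int[P]_x g m x < e.
  have := Icvg; move=> /cvgrPdist_lt /(_ _ e0)[N _ HN].
  exists N; have := HN _ (leqnn N); rewrite /= sub0r normrN => h1.
  exact: le_lt_trans (ler_norm _) h1.
exists (m0 + m).+1%:R^-1, (g m); split => //.
  apply: (integrable_ae_dominated (c := fun x => c x + c x)) => //.
  - exact: integrable_add.
  - by apply: filterS g_le => x; apply.
apply: filterS2 bnd h_cont => x ub cx z' Az' zz'.
apply/ler_addgt0Pl => b b0.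
have := cx z'; move=> /cvgrPdist_le /(_ _ b0) /nbhs_ballP[dl /= dl0 hdl].
have r0 : 0 < Num.min dl ((m0 + m).+1%:R^-1 - `|z' - z|).
  by rewrite lt_min dl0 subr_gt0.
have [i] := D_dense Az' r0; rewrite lt_min => /andP[i1 i2].
have iz : `|D i - z| < (m0 + m).+1%:R^-1.
  rewrite -(subrK z' (D i)) -addrA (le_lt_trans (ler_normD _ _))//.
  by rewrite -ltrBrDr.
rewrite -(subrK (h x (D i)) (h x z')) -addrA (le_trans (ler_normD _ _))//.
apply: lerD.
  by apply: hdl; rewrite -ball_normE/= distrC.
rewrite -lee_fin -(fG _ _ _ (ub m)); apply: le_trans (uG m i x).
by rewrite /u iz.
Unshelve. all: by end_near. Qed.

(** The exceptional null set must not depend on [z]. Countably many centers [D i]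
    and radii are used: whenever some integrable function with small integral
    dominates the oscillation on such a ball, the strong law is applied
    to it and to [h] at the center. Around any [z] a
    ball of this kind exists by [oscillation_small]. *)
Theorem uniform_lln : {ae PO, forall w, forall z, A z -> forall e : R, 0 < e ->
  exists2 r : R, 0 < r & \forall n \near \oo, forall z', A z' -> `|z' - z| < r ->
    `|n%:R^-1 * \sum_(j < n) h (smp j w) z' - \int[P]_x h x z| <= e}.
Proof.
pose dom i m (c : S -> R) x := forall z', A z' -> `|z' - D i| < m.+1%:R^-1 ->
  `|h x z' - h x (D i)| <= c x.
pose good i m k c := [/\ P.-integrable setT (EFin \o c),
  \int[P]_x c x < k.+1%:R^-1 & {ae P, forall x, dom i m c x}].
have E1 : {ae PO, forall w, forall i m k, (exists c, good i m k c) ->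
    exists c, (forall j, dom i m c (smp j w)) /\
      \forall n \near \oo, n%:R^-1 * \sum_(j < n) c (smp j w) <= k.+1%:R^-1}.
  do 3 apply: ae_foralln => ?.
  set i := (X in exists c, good X _ _ c); set m := (X in exists c, good _ X _ c).
  set k := (X in exists c, good _ _ X c).
  have [[c [ic Ic dc]]|ngood] := pselect (exists c, good i m k c); last first.
    by apply: aeW => w /ngood.
  by apply: filterS2 (lln ic Ic) (ae_smp dc) => w h1 h2 _; exists c.
have E2 : {ae PO, forall w, forall i k, \forall n \near \oo,
    n%:R^-1 * \sum_(j < n) h (smp j w) (D i) <= \int[P]_x h x (D i) + k.+1%:R^-1}.
  do 2 apply: ae_foralln => ?.
  by apply: (lln (h_int (AD _))); rewrite ltrDl invr_gt0.
have E3 : {ae PO, forall w, forall i k, \forall n \near \oo,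
    n%:R^-1 * \sum_(j < n) - h (smp j w) (D i) <= - (\int[P]_x h x (D i)) + k.+1%:R^-1}.
  apply: ae_foralln => i; apply: ae_foralln => k.
  have NE : (fun x => - h x (D i)) = (fun x => -1 * h x (D i)).
    by apply/funext => x; rewrite mulN1r.
  apply: (lln (h := fun x => - h x (D i))).
    by rewrite NE; exact: integrable_scale (h_int (AD i)).
  by rewrite NE RintegralZl ?mulN1r ?ltrDl ?invr_gt0//; exact: h_int.
apply: filterS3 E1 E2 E3 => w e1 e2 e3 z Az e e0.
have [k] := exists_invn_lt (divr_gt0 e0 (ltr0n R 3)).
set a : R := k.+1%:R^-1 => ke.
have k0 : 0 < a / 2 by rewrite divr_gt0// invr_gt0.
have [r [c [r0 ic Ic dc]]] := oscillation_small Az k0.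
have [m] := exists_invn_lt (divr_gt0 r0 (ltr0n R 2)).
set b : R := m.+1%:R^-1 => mr.
have m0 : 0 < b by rewrite invr_gt0.
have [i iz] := D_dense Az m0.
(* The ball around [D i] lies in the ball of radius [r] around [z], and passing
   through [z] doubles the oscillation. *)
have Good : exists c, good i m k c.
  exists (fun x => 2 * c x); split.
  - exact: integrable_scale.
  - by rewrite RintegralZl// -/a; lra.
  - apply: filterS dc => x dx z' Az'; rewrite -/b => zi.
    have zz : `|z' - z| < r.
      rewrite -(subrK (D i) z') -addrA (le_lt_trans (ler_normD _ _))//; lra.
    have iz' : `|D i - z| < r by lra.
    have := dx _ Az' zz; have := dx _ (AD i) iz'.
    rewrite (distrC (h x (D i))) => h1 h2.
    rewrite -(subrK (h x z) (h x z')) -addrA (le_trans (ler_normD _ _))//; lra.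
have [c1 [dc1 lc1]] := e1 _ _ _ Good.
have Dz : `|\int[P]_x h x (D i) - \int[P]_x h x z| <= a.
  rewrite -RintegralB//; try exact: h_int.
  apply: le_trans (_ : \int[P]_x c x <= _); last lra.
  apply: le_trans (le_normr_Rintegral _ _) _ => //.
    exact: integrable_sub (h_int (AD i)) (h_int Az).
  apply: le_Rintegral_ae => //.
  - have := integrable_norm (integrable_sub (h_int (AD i)) (h_int Az)); exact.
  - by apply: filterS dc => x dx; apply: dx => //; lra.
exists (b - `|D i - z|); first by rewrite subr_gt0.
rewrite -/a in lc1.
apply: filterS3 lc1 (e2 i k) (e3 i k) => n a1; rewrite -/a => a2 a3 z' Az' zz'.
have zi : `|z' - D i| < b.
  rewrite -(subrK z z') -addrA (le_lt_trans (ler_normD _ _))//.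
  by rewrite (distrC z) -ltrBrDr.
have n0 : 0 <= n%:R^-1 :> R by rewrite invr_ge0.
have b1 : `|n%:R^-1 * \sum_(j < n) h (smp j w) z' -
    n%:R^-1 * \sum_(j < n) h (smp j w) (D i)| <= a.
  apply: le_trans a1; rewrite -mulrBr -sumrB normrM ger0_norm//.
  rewrite ler_wpM2l//; apply: le_trans (ler_norm_sum _ _ _) _.
  by apply: ler_sum => j _; exact: dc1.
move: a3; rewrite sumrN mulrN => a3.
move: b1 Dz; rewrite !ler_norml => /andP[b1 b1'] /andP[b2 b2']; apply/andP; split; lra.
Unshelve. all: by end_near. Qed.
End uniform_lln.

(** * Dense sequences and Euclidean balls *)

Section dense_sequence.
Context (R : realType).

Lemma dense_sequence_subset (V : normedModType R) (q : nat -> V) (A : set V) :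
  (forall z (r : R), 0 < r -> exists i, `|q i - z| < r) -> A !=set0 ->
  exists D : nat -> V, (forall i, A (D i)) /\
    forall z (r : R), A z -> 0 < r -> exists i, `|D i - z| < r.
Proof.
move=> q_dense [a0 Aa0].
pose near_pt (im : nat * nat) := [set a | A a /\ `|q im.1 - a| < im.2.+1%:R^-1].
pose D k := if unpickle k is Some im then
    (if pselect (near_pt im !=set0) is left h then projT1 (cid h) else a0) else a0.
exists D; split.
  move=> k; rewrite /D; case: unpickle => [im|//]; case: pselect => // h.
  by case: cid => a /= [].
move=> z r Az r0; have [m mr] := exists_invn_lt (divr_gt0 r0 (ltr0n R 2)).
have m0 : 0 < m.+1%:R^-1 :> R by rewrite invr_gt0.
have [i iz] := q_dense z _ m0.
exists (pickle (i, m)); rewrite /D pickleK; case: pselect => [h|]; last first.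
  by move=> nh; exfalso; apply: nh; exists z.
case: cid => a /= [_ ia]; rewrite -(subrK (q i) a) -addrA.
rewrite (le_lt_trans (ler_normD _ _))// distrC.
by move: mr ia iz; set b := _^-1; lra.
Qed.

Definition rat_point n (p : 'rV[rat]_n * (rat * rat)) : 'rV[R]_n * (R * R) :=
  (map_mx ratr p.1, (ratr p.2.1, ratr p.2.2)).

Lemma rat_approx (x r : R) : 0 < r -> exists q : rat, `|x - ratr q| < r.
Proof.
move=> r0; have xr : x - r < x + r by lra.
have [q] := rat_in_itvoo xr; rewrite in_itv/= => /andP[h1 h2]; exists q.
by rewrite ltr_distlC; apply/andP; split.
Qed.

Lemma rat_point_dense n : exists q : nat -> 'rV[R]_n * (R * R),
  forall z (r : R), 0 < r -> exists i, `|q i - z| < r.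
Proof.
exists (fun k => if unpickle k is Some p then rat_point p else 0) => z r r0.
have apx x := cid (rat_approx x r0).
pose p : 'rV[rat]_n * (rat * rat) :=
  (\row_i projT1 (apx (z.1 ord0 i)), (projT1 (apx z.2.1), projT1 (apx z.2.2))).
exists (pickle p); rewrite pickleK distrC.
suff : ball z r (rat_point p) by rewrite -ball_normE.
have apxP x : ball x r (ratr (projT1 (apx x)) : R).
  by rewrite -ball_normE /=; case: (apx x).
split; last by split; exact: apxP.
by split=> // i j; rewrite !mxE !ord1; exact: apxP.
Qed.

Lemma dense_sequence n (A : set ('rV[R]_n * (R * R))) : A !=set0 ->
  exists D : nat -> 'rV[R]_n * (R * R), (forall i, A (D i)) /\
    forall z (r : R), A z -> 0 < r -> exists i, `|D i - z| < r.
Proof.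
have [q hq] := rat_point_dense n.
exact: (@dense_sequence_subset ('rV[R]_n * (R * R))%type q A hq).
Qed.

Lemma norm_fst_le (V W : normedModType R) (z : V * W) : `|z.1| <= `|z|.
Proof. by rewrite [leRHS]prod_normE le_max lexx. Qed.

Lemma norm_snd_le (V W : normedModType R) (z : V * W) : `|z.2| <= `|z|.
Proof. by rewrite [leRHS]prod_normE le_max lexx orbT. Qed.

Lemma norm_entry_le n (v : 'rV[R]_n) i : `|v ord0 i| <= `|v|.
Proof.
have -> : `|v| = mx_norm v by [].
by rewrite mx_normrE; exact: (le_bigmax _ (fun i => `|v i.1 i.2|) (ord0, i)).
Qed.

(** The constant is crude: each of the [n + 2] squared coordinates is bounded by
    the squared maximum norm. *)
Lemma eucl_norm_le n (z : 'rV[R]_n * (R * R)) (rho : R) : 0 <= rho ->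
  `|z| <= rho / n.+2%:R -> eucl_norm z <= rho.
Proof.
move=> rho0 zr; rewrite /eucl_norm -(ger0_norm rho0) -sqrtr_sqr.
apply: ler_wsqrtr.
have n0 : (0 : R) < n.+2%:R by [].
have sq x : `|x| <= `|z| -> x ^+ 2 <= rho ^+ 2 / n.+2%:R.
  move=> xz; rewrite -real_normK ?num_real//.
  have h := le_trans xz zr.
  apply: (@le_trans _ _ ((rho / n.+2%:R) ^+ 2)).
    by rewrite ler_pXn2r// nnegrE// divr_ge0.
  rewrite expr_div_n ler_wpM2l ?sqr_ge0// lef_pV2 ?posrE ?exprn_gt0//.
  by rewrite expr2 ler_peMl ?ler1n// ltW.
have z1 i : `|z.1 ord0 i| <= `|z|.
  by apply: le_trans (norm_entry_le _ _) _; exact: norm_fst_le.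
have z2 : `|z.2| <= `|z| by exact: norm_snd_le.
have z21 : `|z.2.1| <= `|z| by apply: le_trans z2; exact: norm_fst_le.
have z22 : `|z.2.2| <= `|z| by apply: le_trans z2; exact: norm_snd_le.
apply: (@le_trans _ _ (\sum_(i < n) (rho ^+ 2 / n.+2%:R) + rho ^+ 2 / n.+2%:R +
    rho ^+ 2 / n.+2%:R)).
  by rewrite !lerD ?sq//; apply: ler_sum => i _; exact: sq.
rewrite sumr_const card_ord -!mulrSr -[leLHS]mulr_natr divfK//.
Qed.

End dense_sequence.

(** * Smoothing of the positive part *)

Section smoothing.
Context (R : realType).

Lemma smax_bounds (t b : R) : 0 < b ->
  Num.max 0 t <= smax t b <= Num.max 0 t + b * ln 2.
Proof.
move=> b0; rewrite /smax.
have l0 : (0 : R) < 1 + expR (t / b) by rewrite addr_gt0// expR_gt0.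
have [t0|t0] := leP t 0.
  have e1 : expR (t / b) <= 1 by rewrite expR_le1// pmulr_lle0 ?invr_gt0.
  rewrite add0r ler_pM2l// ler_ln ?posrE//; apply/andP; split; last lra.
  by rewrite mulr_ge0 ?ltW// ln_gt0// ltrDl expR_gt0.
have e1 : 1 <= expR (t / b) by rewrite -[leLHS]expR0 ler_expR divr_ge0// ltW.
have tE : t = b * ln (expR (t / b)) by rewrite expRK mulrC divfK// gt_eqF.
apply/andP; split.
  rewrite [leLHS]tE ler_pM2l// ler_ln ?posrE ?expR_gt0//; lra.
rewrite [in leRHS]tE -mulrDr ler_pM2l// -lnM ?posrE ?expR_gt0//.
by rewrite ler_ln ?posrE ?mulr_gt0 ?expR_gt0//; lra.
Qed.

Lemma smax_near_max (t b : R) : 0 < b -> `|smax t b - Num.max 0 t| <= b * ln 2.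
Proof.
move=> b0; have /andP[h1 h2] := smax_bounds t b0.
by rewrite ger0_norm ?subr_ge0// lerBlDl.
Qed.
End smoothing.

(** * Sample averages along approximate solution mappings *)

Section approximate_solution_lln.
Context (R : realType) dS (S : measurableType dS) (P : probability S R).
Context dO (Om : measurableType dO) (PO : probability Om R) (smp : nat -> Om -> S).
Hypothesis lln : forall (h : S -> R) (c : R), P.-integrable setT (EFin \o h) ->
  \int[P]_x h x < c ->
  {ae PO, forall w, \forall n \near \oo, n%:R^-1 * \sum_(j < n) h (smp j w) <= c}.
Hypothesis ae_smp : forall Q : S -> Prop, {ae P, forall x, Q x} ->
  {ae PO, forall w, forall j, Q (smp j w)}.

Context (V U : normedModType R) (Z : Type) (A : set V) (D : nat -> V) (T : V -> Z).
Context (s : S -> Z -> U) (snu : nat -> S -> Z -> U) (g : U -> Z -> R).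
Hypothesis AD : forall i, A (D i).
Hypothesis D_dense : forall z (r : R), A z -> 0 < r -> exists i, `|D i - z| < r.
Let h x z := g (s x (T z)) (T z).
Hypothesis h_cont : {ae P, forall x, continuous (h x)}.
Hypothesis h_int : forall z, A z -> P.-integrable setT (EFin \o h^~ z).
Hypothesis h_dom : forall z, A z -> exists (rho : R) (c : S -> R),
  [/\ 0 < rho, P.-integrable setT (EFin \o c) &
      forall z', A z' -> `|z' - z| < rho -> {ae P, forall x, `|h x z'| <= c x}].

Context (eta kappa : R) (lam mu : S -> R) (pi Delta0 : V -> R) (Delta : nat -> V -> R).
Hypothesis (eta0 : 0 < eta) (kappa0 : 0 < kappa).
Hypothesis lam_mu0 : forall x, 0 <= lam x /\ 0 <= mu x.
Hypothesis pi0 : forall z, A z -> 0 <= pi z.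
Hypothesis int_lam_mu : P.-integrable setT (fun x => (lam x `^ eta * mu x `^ kappa)%:E).
Hypothesis int_mu : P.-integrable setT (fun x => (mu x `^ kappa)%:E).
Hypothesis g_holder : forall z, A z -> forall u u',
  `|g u (T z) - g u' (T z)| <=
    pi z * (`|u| `^ eta + `|u'| `^ eta + 1) * `|u - u'| `^ kappa.
Hypothesis s_bound : {ae P, forall x, forall z, A z -> forall n, (0 < n)%N ->
  Num.max `|s x (T z)| `|snu n x (T z)| <= lam x * Delta0 z /\
  `|snu n x (T z) - s x (T z)| <= mu x * Delta n z}.
Hypothesis local_bound : forall z, A z -> exists (r K M : R),
  [/\ 0 < r,
      forall z', A z' -> `|z' - z| < r -> pi z' <= K /\ Delta0 z' <= M &
      forall e : R, 0 < e -> \forall n \near \oo,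
        forall z', A z' -> `|z' - z| < r -> Delta n z' <= e].

(** The Hoelder estimate factors into a deterministic small factor [e `^ kappa] and
    a random factor that is integrable by assumption, so that its sample
    averages stay bounded. *)
Lemma holder_error_bound x z n (K M e : R) : A z -> 0 <= K -> 0 <= M -> 0 <= e ->
  pi z <= K -> Delta0 z <= M -> Delta n z <= e ->
  Num.max `|s x (T z)| `|snu n x (T z)| <= lam x * Delta0 z ->
  `|snu n x (T z) - s x (T z)| <= mu x * Delta n z ->
  `|g (snu n x (T z)) (T z) - h x z| <=
  K * e `^ kappa * (2 * M `^ eta * (lam x `^ eta * mu x `^ kappa) + mu x `^ kappa).
Proof.
move=> Az K0 M0 e0 pK dM de; rewrite ge_max => /andP[h1 h2] h3.
have [l0 m0] := lam_mu0 x.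
have n1 : `|s x (T z)| `^ eta <= lam x `^ eta * M `^ eta.
  rewrite -powRM// ge0_ler_powR ?nnegrE ?mulr_ge0// ?(ltW eta0)//.
  by apply: le_trans h1 _; rewrite ler_wpM2l.
have n2 : `|snu n x (T z)| `^ eta <= lam x `^ eta * M `^ eta.
  rewrite -powRM// ge0_ler_powR ?nnegrE ?mulr_ge0// ?(ltW eta0)//.
  by apply: le_trans h2 _; rewrite ler_wpM2l.
have n3 : `|snu n x (T z) - s x (T z)| `^ kappa <= mu x `^ kappa * e `^ kappa.
  rewrite -powRM// ge0_ler_powR ?nnegrE ?mulr_ge0// ?(ltW kappa0)//.
  by apply: le_trans h3 _; rewrite ler_wpM2l.
apply: le_trans (g_holder Az _ _) _.
apply: (@le_trans _ _ (K * (2 * M `^ eta * lam x `^ eta + 1) *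
    (mu x `^ kappa * e `^ kappa))); last first.
  by rewrite le_eqVlt; apply/orP; left; apply/eqP; ring.
have p1 := powR_ge0 `|s x (T z)| eta; have p2 := powR_ge0 `|snu n x (T z)| eta.
apply: ler_pM => //; rewrite ?powR_ge0//.
  by apply: mulr_ge0; [exact: pi0|lra].
apply: ler_pM => //; first [exact: pi0 | lra].
Qed.

Theorem approximate_solution_lln :
  {ae PO, forall w, forall z, A z -> forall e : R, 0 < e ->
  exists2 r : R, 0 < r & \forall n \near \oo, forall z', A z' -> `|z' - z| < r ->
    `|n%:R^-1 * \sum_(j < n) g (snu n (smp j w) (T z')) (T z') - \int[P]_x h x z| <= e}.
Proof.
pose I1 := \int[P]_x (lam x `^ eta * mu x `^ kappa).
pose I2 := \int[P]_x (mu x `^ kappa).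
have I10 : 0 <= I1 by apply: Rintegral_ge0 => x _; rewrite mulr_ge0 ?powR_ge0.
have I20 : 0 <= I2 by apply: Rintegral_ge0 => x _; exact: powR_ge0.
have E1 := uniform_lln lln ae_smp AD D_dense h_cont h_int h_dom.
have E2 := ae_smp s_bound.
have lt1 (a : R) : a < a + 1 by rewrite ltrDl.
have E3 := lln int_lam_mu (lt1 I1).
have E4 := lln int_mu (lt1 I2).
have E34 : {ae PO, forall w,
    (\forall n \near \oo,
      n%:R^-1 * \sum_(j < n) (lam (smp j w) `^ eta * mu (smp j w) `^ kappa) <= I1 + 1) /\
    (\forall n \near \oo, n%:R^-1 * \sum_(j < n) (mu (smp j w) `^ kappa) <= I2 + 1)}.
  by apply: filterS2 E3 E4 => w.
apply: filterS3 E1 E2 E34 => w u_lln bnd [a1 a2] z Az e e0.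
have e2 : 0 < e / 2 by rewrite divr_gt0.
have [r1 r10 lln1] := u_lln z Az _ e2.
have [r2 [K' [M' [r20 KM dsmall]]]] := local_bound Az.
pose K := Num.max 0 K'; pose M := Num.max 0 M'.
have K0 : 0 <= K by rewrite le_max lexx.
have M0 : 0 <= M by rewrite le_max lexx.
pose C := K * (2 * M `^ eta * (I1 + 1) + (I2 + 1)).
have C0 : 0 <= C.
  by rewrite mulr_ge0// addr_ge0 ?mulr_ge0 ?powR_ge0// addr_ge0.
(* [d] is chosen so that [C * d `^ kappa <= e / 2]. *)
pose q := e / 2 / (C + 1).
have q0 : 0 < q by rewrite divr_gt0// ltr_wpDl.
pose d := q `^ kappa^-1.
have d0 : 0 < d by exact: powR_gt0.
have dq : d `^ kappa = q by rewrite -powRrM mulVf ?gt_eqF// powRr1// ltW.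
exists (Num.min r1 r2); first by rewrite lt_min r10.
have a12 : \forall n \near \oo,
    n%:R^-1 * \sum_(j < n) (lam (smp j w) `^ eta * mu (smp j w) `^ kappa) <= I1 + 1 /\
    n%:R^-1 * \sum_(j < n) (mu (smp j w) `^ kappa) <= I2 + 1 /\ (0 < n)%N.
  by apply: filterS3 a1 a2 (nbhs_infty_gt 0%N) => n.
apply: filterS3 lln1 (dsmall _ d0) a12 => n h1 h2 [b1 [b2 n0]] z' Az' zz'.
have {zz'} [z1 z2] : `|z' - z| < r1 /\ `|z' - z| < r2.
  by move: zz'; rewrite lt_min => /andP[].
have n1 : 0 <= n%:R^-1 :> R by rewrite invr_ge0.
have [pK dM] := KM _ Az' z2.
have err : `|n%:R^-1 * \sum_(j < n) g (snu n (smp j w) (T z')) (T z') -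
    n%:R^-1 * \sum_(j < n) h (smp j w) z'| <= e / 2.
  rewrite -mulrBr -sumrB normrM ger0_norm//.
  apply: (@le_trans _ _ (n%:R^-1 * \sum_(j < n) (K * q *
      (2 * M `^ eta * (lam (smp j w) `^ eta * mu (smp j w) `^ kappa) + mu (smp j w) `^ kappa)))).
    rewrite ler_wpM2l//; apply: le_trans (ler_norm_sum _ _ _) _.
    apply: ler_sum => j _; have [s1 s2] := bnd j z' Az' n n0.
    rewrite -dq; apply: holder_error_bound => //; rewrite ?(ltW d0) ?le_max ?pK ?dM ?orbT//.
    exact: h2.
  rewrite -mulr_sumr big_split/= -mulr_sumr mulrCA mulrDr [n%:R^-1 * (2 * _ * _)]mulrCA.
  apply: (@le_trans _ _ (K * q * (2 * M `^ eta * (I1 + 1) + (I2 + 1)))).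
    have Kq : 0 <= K * q by rewrite mulr_ge0// ltW.
    rewrite ler_wpM2l// lerD// ler_wpM2l// mulr_ge0 ?powR_ge0//.
  have -> : K * q * (2 * M `^ eta * (I1 + 1) + (I2 + 1)) = q * C.
    by rewrite /C mulrAC mulrC.
  rewrite /q mulrAC ler_pdivrMr ?ltr_wpDl//.
  by apply: ler_wpM2l; [exact: ltW|rewrite lerDl].
have := h1 _ Az' z1.
by move: err; rewrite !ler_norml => /andP[? ?] /andP[? ?]; apply/andP; split; lra.
Qed.
End approximate_solution_lln.

(** * Cluster points of penalized minimizers *)

Section penalty_cluster.
Context (R : realType) (V : normedModType R) (A : set V).
Context (F m ps : V -> R) (c S : nat -> V -> R) (y theta : nat -> R).
Context (lift : V -> R -> V).

Let phi n z : \bar R :=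
  (iota_set A z + (F z + c n z + y n * S n z + theta n * S n z ^+ 2)%:E)%E.

Hypothesis A_closed : closed A.
Hypothesis F_cont : forall z, A z -> forall e : R, 0 < e ->
  exists2 r : R, 0 < r & forall z', A z' -> `|z' - z| < r -> `|F z' - F z| <= e.
Hypothesis conv : forall z, A z -> forall e : R, 0 < e ->
  exists2 r : R, 0 < r & \forall n \near \oo, forall z', A z' -> `|z' - z| < r ->
    `|c n z' - m z| <= e /\ `|S n z' - ps z| <= e.
Hypothesis qualification : forall z, A z -> ps z = 0 -> forall r : R, 0 < r ->
  exists z', [/\ A z', `|z' - z| < r & ps z' < 0].
Hypothesis lift_feas : forall z t, A z -> 0 <= t -> A (lift z t).
Hypothesis lift_F : forall z t, F (lift z t) = F z.
Hypothesis lift_c : forall n z t, c n (lift z t) = c n z.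
Hypothesis lift_S : forall n z t, (0 < n)%N -> S n (lift z t) = S n z + t.
Hypothesis y_bounded : exists M : R, forall n, (0 < n)%N -> `|y n| <= M.
Hypothesis theta0 : forall n, (0 < n)%N -> 0 < theta n.
Hypothesis theta_oo : theta @ \oo --> +oo.

(** Locally uniform convergence forces the limit to be continuous: both [m z'] and
    [m z] are close to the same [c n z']. *)
Lemma limit_continuous z : A z -> forall e : R, 0 < e ->
  exists2 r : R, 0 < r & forall z', A z' -> `|z' - z| < r -> `|m z' - m z| <= e.
Proof.
move=> Az e e0; have e2 : 0 < e / 2 by rewrite divr_gt0.
have [r r0 cz] := conv Az e2; exists r => // z' Az' zz'.
have [r' r'0 cz'] := conv Az' e2.
have [n [h1 h2]] : exists n, `|c n z' - m z| <= e / 2 /\ `|c n z' - m z'| <= e / 2.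
  have : \forall n \near \oo, `|c n z' - m z| <= e / 2 /\ `|c n z' - m z'| <= e / 2.
    apply: filterS2 cz cz' => n /(_ z' Az' zz')[? _] /(_ z' Az').
    by rewrite subrr normr0 => /(_ r'0)[].
  by move=> [n _ hn]; exists n; exact: hn (leqnn n).
move: h1 h2; rewrite !ler_norml => /andP[? ?] /andP[? ?]; apply/andP; split; lra.
Qed.

(** A feasible point is first moved to a nearby one with [ps z1 < 0]. There [S n z1] is
    eventually negative, so raising the slack by [- S n z1] is allowed and makes
    the penalty terms vanish exactly, no matter how large [theta n] is. *)
Lemma recovery z : A z -> ps z = 0 -> forall e : R, 0 < e ->
  \forall n \near \oo, (inf_of (phi n) <= (F z + m z + e)%:E)%E.
Proof.
move=> Az pz e e0; have e3 : 0 < e / 3 by rewrite divr_gt0.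
have [r1 r10 Fz] := F_cont Az e3.
have [r2 r20 mz] := limit_continuous Az e3.
have r0 : 0 < Num.min r1 r2 by rewrite lt_min r10.
have [z1 [Az1 + pz1]] := qualification Az pz r0.
rewrite lt_min => /andP[/(Fz _ Az1) {}Fz /(mz _ Az1) {}mz].
have q0 : 0 < Num.min (e / 3) (- ps z1 / 2).
  by rewrite lt_min e3 divr_gt0// oppr_gt0.
have [r r0' cz] := conv Az1 q0.
apply: filterS2 cz (nbhs_infty_gt 0%N) => n cn n0.
have := cn z1 Az1; rewrite subrr normr0 => /(_ r0') []; rewrite !le_min.
move=> /andP[c1 _] /andP[_ s1].
have S0 : S n z1 < 0.
  by move: s1; rewrite ler_norml => /andP[? ?]; lra.
pose z' := lift z1 (- S n z1).
have Az' : A z' by apply: lift_feas => //; rewrite oppr_ge0 ltW.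
apply: le_trans (_ : (phi n z' <= _)%E).
  by apply: ereal_inf_lbound; exists z'.
rewrite /phi /iota_set; case: asboolP => // _; rewrite add0e lee_fin.
rewrite lift_F lift_c lift_S// subrr expr0n/= !mulr0 !addr0.
by move: Fz mz c1; rewrite !ler_norml => /andP[? ?] /andP[? ?] /andP[? ?]; lra.
Qed.

Section cluster.
Variables (deltas : nat -> R) (delta : R) (zs : nat -> V) (zbar : V).
Hypothesis deltas_cvg : deltas @ \oo --> delta.
Hypothesis zs_argmin : forall n, (0 < n)%N -> delta_argmin (deltas n) (phi n) (zs n).
Hypothesis zs_cluster : cluster (zs @ \oo) zbar.

Lemma zs_feas n : (0 < n)%N -> A (zs n).
Proof.
move=> /zs_argmin[+ _]; rewrite /phi /iota_set; case: asboolP => //.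
Qed.

Lemma phi_zs n : (0 < n)%N -> phi n (zs n) =
  (F (zs n) + c n (zs n) + y n * S n (zs n) + theta n * S n (zs n) ^+ 2)%:E.
Proof.
by move=> /zs_feas h; rewrite /phi /iota_set; case: asboolP => // _; rewrite add0e.
Qed.

Lemma frequently_near (r : R) (Q : nat -> Prop) : 0 < r ->
  (\forall n \near \oo, Q n) -> exists n, [/\ (0 < n)%N, Q n & `|zs n - zbar| < r].
Proof.
move=> r0 hQ.
have hQ' : (zs @ \oo) (zs @` [set n | (0 < n)%N /\ Q n]).
  apply: filterS2 hQ (nbhs_infty_gt 0%N) => n Qn n0.
  by exists n.
have := zs_cluster hQ' (nbhsx_ballx zbar r r0).
move=> [_ [[n [n0 Qn] <-]]]; rewrite -ball_normE/= distrC => h.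
by exists n.
Qed.

Lemma cluster_feasible : A zbar.
Proof.
apply: A_closed => B /nbhs_ballP[r /= r0 rB].
have [n [n0 _ h]] := frequently_near r0 (filterT : \forall n \near \oo, setT n).
exists (zs n); split; first exact: zs_feas.
by apply: rB; rewrite -ball_normE/= distrC.
Qed.

Lemma value_bound z : A z -> ps z = 0 -> forall e : R, 0 < e ->
  \forall n \near \oo, F (zs n) + c n (zs n) + y n * S n (zs n) +
    theta n * S n (zs n) ^+ 2 <= F z + m z + delta + e.
Proof.
move=> Az pz e e0; have e2 : 0 < e / 2 by rewrite divr_gt0.
have hd : \forall n \near \oo, `|delta - deltas n| <= e / 2.
  by move/cvgrPdist_le : deltas_cvg; apply.
apply: filterS3 (recovery Az pz e2) hd (nbhs_infty_gt 0%N) => n h1 h2 n0.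
have [_] := zs_argmin n0; rewrite phi_zs// => h3.
have : (inf_of (phi n) + (deltas n)%:E <= (F z + m z + e / 2)%:E + (deltas n)%:E)%E.
  by rewrite leeD2r.
move/(le_trans h3); rewrite -EFinD lee_fin.
by move: h2; rewrite ler_norml => /andP[? ?]; lra.
Qed.

(** The minimal values are bounded above by [recovery], so the quadratic penalty with
    [theta] unbounded excludes [ps zbar <> 0]. Once [ps zbar = 0] the linear term
    vanishes in the limit and the quadratic one is nonnegative, so what remains
    is [F zbar + m zbar]. *)
Theorem cluster_optimal : (exists z, A z /\ ps z = 0) ->
  [/\ A zbar, ps zbar = 0 &
      forall z, A z -> ps z = 0 -> F zbar + m zbar <= F z + m z + delta].
Proof.
move=> [z0 [Az0 pz0]]; have Ab := cluster_feasible.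
have [M' hM'] := y_bounded; pose M := Num.max 0 M'.
have M0 : 0 <= M by rewrite le_max lexx.
have yM n : (0 < n)%N -> `|y n| <= M by move=> /hM'; rewrite le_max orbC => ->.
have pb : ps zbar = 0.
  apply/eqP/negPn/negP => pb; pose p := `|ps zbar|.
  have p0 : 0 < p by rewrite normr_gt0.
  have q0 : 0 < Num.min 1 (p / 2) by rewrite lt_min ltr01 divr_gt0.
  have [r1 r10 Fz] := F_cont Ab (@ltr01 R).
  have [r2 r20 cz] := conv Ab q0.
  have r0 : 0 < Num.min r1 r2 by rewrite lt_min r10.
  pose L := F z0 + m z0 + delta + 1.
  (* Above this value of [theta n] the penalty alone exceeds the bound [L]. *)
  pose K := (L - F zbar - m zbar + 2 + M * (2 * p) + 1) / (p / 2) ^+ 2.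
  have th : \forall n \near \oo, K <= theta n by move/cvgryPge : theta_oo; apply.
  have ev : \forall n \near \oo, K <= theta n /\ (F (zs n) + c n (zs n) + y n * S n (zs n) +
      theta n * S n (zs n) ^+ 2 <= L) /\ (forall z', A z' -> `|z' - zbar| < r2 ->
      `|c n z' - m zbar| <= Num.min 1 (p / 2) /\ `|S n z' - ps zbar| <= Num.min 1 (p / 2)).
    by apply: filterS3 th (value_bound Az0 pz0 (@ltr01 R)) cz => n ? ? ?.
  have [n [n0 [Kn [vn cn]]]] := frequently_near r0 ev.
  rewrite lt_min => /andP[/(Fz _ (zs_feas n0)) h1 /(cn _ (zs_feas n0)) [h2 h3]].
  have {}h2 : `|c n (zs n) - m zbar| <= 1 by move: h2; rewrite le_min => /andP[].
  have {}h3 : `|S n (zs n) - ps zbar| <= p / 2 by move: h3; rewrite le_min => /andP[].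
  have s1 : `|S n (zs n)| <= 2 * p.
    by have := ler_normD (S n (zs n) - ps zbar) (ps zbar); rewrite subrK -/p; lra.
  have s2 : p / 2 <= `|S n (zs n)|.
    have := ler_normD (ps zbar - S n (zs n)) (S n (zs n)); rewrite subrK -/p.
    by rewrite distrC; lra.
  have s3 : (p / 2) ^+ 2 <= S n (zs n) ^+ 2.
    rewrite -[leRHS]real_normK ?num_real// ler_pXn2r// nnegrE//.
    by rewrite divr_ge0// ltW.
  have ys : - (M * (2 * p)) <= y n * S n (zs n).
    have : `|y n * S n (zs n)| <= M * (2 * p) by rewrite normrM ler_pM// yM.
    by rewrite ler_norml => /andP[].
  have pp : 0 < (p / 2) ^+ 2 by rewrite exprn_gt0// divr_gt0.
  have ts : L - F zbar - m zbar + 2 + M * (2 * p) + 1 <= theta n * S n (zs n) ^+ 2.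
    apply: (@le_trans _ _ (theta n * (p / 2) ^+ 2)).
      by rewrite -ler_pdivrMr.
    by rewrite ler_wpM2l// ltW// theta0.
  move: h1 h2 vn; rewrite !ler_norml => /andP[? ?] /andP[? ?] ?; lra.
split => // z Az pz; apply/ler_addgt0Pr => e e0.
pose e' := e / (M + 3).
have M3 : 0 < M + 3 by lra.
have e'0 : 0 < e' by rewrite divr_gt0.
have eE : e = e' * (M + 3) by rewrite divfK// gt_eqF.
have [r1 r10 Fz] := F_cont Ab e'0.
have [r2 r20 cz] := conv Ab e'0.
have r0 : 0 < Num.min r1 r2 by rewrite lt_min r10.
have ev : \forall n \near \oo, (F (zs n) + c n (zs n) + y n * S n (zs n) +
    theta n * S n (zs n) ^+ 2 <= F z + m z + delta + e') /\
    (forall z', A z' -> `|z' - zbar| < r2 ->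
    `|c n z' - m zbar| <= e' /\ `|S n z' - ps zbar| <= e').
  by apply: filterS2 (value_bound Az pz e'0) cz => n ? ?.
have [n [n0 [vn cn]]] := frequently_near r0 ev.
rewrite lt_min => /andP[/(Fz _ (zs_feas n0)) h1 /(cn _ (zs_feas n0)) [h2]].
rewrite pb subr0 => h3.
have ys : - (M * e') <= y n * S n (zs n).
  have : `|y n * S n (zs n)| <= M * e' by rewrite normrM ler_pM// yM.
  by rewrite ler_norml => /andP[].
have ts : 0 <= theta n * S n (zs n) ^+ 2.
  by rewrite mulr_ge0 ?sqr_ge0// ltW// theta0.
rewrite eE mulrDr (mulrC e' M).
move: h1 h2 vn; rewrite !ler_norml => /andP[? ?] /andP[? ?] ?; lra.
Qed.
End cluster.
End penalty_cluster.

(** * Convergence at a fixed discretization level *)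

Lemma le_of_ereal_sup_ltey (R : realType) (T : Type) (f : T -> R) (B : set T) :
  (ereal_sup [set (f z)%:E | z in B] < +oo)%E -> exists K, forall z, B z -> f z <= K.
Proof.
have ub z : B z -> ((f z)%:E <= ereal_sup [set (f z)%:E | z in B])%E.
  by move=> Bz; apply: ereal_sup_ubound; exists z.
case: ereal_sup ub => [r|//|] ub _; first by exists r => z /ub; rewrite lee_fin.
by exists 0 => z /ub.
Qed.

Lemma ae_components_le d (T : measurableType d) (R : realType) (P : probability T R)
    (f : T -> R * R) (c : T -> R) :
  {ae P, forall x, `|f x| <= c x} ->
  {ae P, forall x, `|(f x).1| <= c x /\ `|(f x).2| <= c x}.
Proof.
apply: filterS => x h; split; apply: le_trans h.
  exact: (@norm_fst_le R R R).
exact: (@norm_snd_le R R R).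
Qed.

Section sample_convergence.
Context (R : realType) dS (S : measurableType dS) (P : probability S R).
Context dO (Om : measurableType dO) (PO : probability Om R) (smp : nat -> Om -> S).
Hypothesis lln : forall (h : S -> R) (c : R), P.-integrable setT (EFin \o h) ->
  \int[P]_x h x < c ->
  {ae PO, forall w, \forall n \near \oo, n%:R^-1 * \sum_(j < n) h (smp j w) <= c}.
Hypothesis ae_smp : forall Q : S -> Prop, {ae P, forall x, Q x} ->
  {ae PO, forall w, forall j, Q (smp j w)}.
Context (Zhat U : completeNormedModType R).
Context (alpha : R) (Ahat : set Zhat) (ghat1 ghat2 : U -> Zhat -> R).
Context (s : S -> Zhat -> U) (snu : nat -> S -> Zhat -> U).
Context (n : nat) (That : 'rV[R]_n -> Zhat) (beta : nat -> R).

Let Z : normedModType R := (Zhat * (R * R))%type.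
Let Zn : normedModType R := ('rV[R]_n * (R * R))%type.
Let A : set Z := feas Ahat.
Let T : Zn -> Z := Tmap That.
Let An : set Zn := feas_n Ahat That.
Let G : S -> Z -> R * R := Gmap alpha ghat1 ghat2 s.

Hypothesis alpha1 : alpha < 1.
Hypothesis G_int : forall z, A z -> P.-integrable setT (fun x => (G x z).1%:E) /\
                    P.-integrable setT (fun x => (G x z).2%:E).
Hypothesis s_cont : {ae P, forall x, continuous (fun z : Z => s x z.1)}.
Hypothesis g1_cont : continuous (fun uz : U * Z => g1 ghat1 uz.1 uz.2).
Hypothesis g2_cont : continuous (fun uz : U * Z => g2 alpha ghat2 uz.1 uz.2).
Hypothesis T_cont : continuous T.
Hypothesis G_dom : forall zbar, An zbar ->
      exists (rho : R) (c : S -> R),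
        [/\ 0 < rho, (forall x, 0 <= c x),
            P.-integrable setT (fun x => (c x)%:E)
          & forall zn, eucl_ball zbar rho zn -> An zn ->
              {ae P, forall x, `|G x (T zn)| <= c x}].
Hypothesis growth : exists (eta kappa : R) (lambda mu : S -> R)
            (rho pi Delta0 : Zn -> R) (Delta : nat -> Zn -> R),
      [/\ 0 < eta, 0 < kappa &
          forall x, 0 <= lambda x /\ 0 <= mu x] /\
      (forall zn, An zn ->
        [/\ 0 < rho zn, 0 < pi zn, 0 <= Delta0 zn
          & forall nu, (0 < nu)%N -> 0 <= Delta nu zn]) /\
      (P.-integrable setT (fun x => (lambda x `^ eta * mu x `^ kappa)%:E) /\
       P.-integrable setT (fun x => (mu x `^ kappa)%:E)) /\
      (forall zn, An zn -> forall u u' : U,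
        `|g1 ghat1 u (T zn) - g1 ghat1 u' (T zn)| <=
          pi zn * (`|u| `^ eta + `|u'| `^ eta + 1) * `|u - u'| `^ kappa /\
        `|g2 alpha ghat2 u (T zn) - g2 alpha ghat2 u' (T zn)| <=
          pi zn * (`|u| `^ eta + `|u'| `^ eta + 1) * `|u - u'| `^ kappa) /\
      {ae P, forall x, forall zn, An zn -> forall nu, (0 < nu)%N ->
        Num.max `|s x (T zn).1| `|snu nu x (T zn).1|
          <= lambda x * Delta0 zn /\
        `|snu nu x (T zn).1 - s x (T zn).1| <= mu x * Delta nu zn} /\
      (forall zbar, An zbar ->
        let B := eucl_ball zbar (rho zbar) `&` An in
        [/\ (ereal_sup [set (pi zn)%:E | zn in B] < +oo)%E,
            (ereal_sup [set (Delta0 zn)%:E | zn in B] < +oo)%E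
          & (fun nu => ereal_sup [set (Delta nu zn)%:E | zn in B]) @ \oo
              --> 0%E]).
Hypothesis beta0 : forall nu, (0 < nu)%N -> 0 < beta nu.
Hypothesis beta_cvg : beta @ \oo --> 0.

Lemma eucl_ball_near (zbar z : Zn) (rho : R) : 0 < rho ->
  `|z - zbar| < rho / n.+2%:R -> eucl_ball zbar rho z.
Proof. by move=> rho0 h; apply: eucl_norm_le; exact: ltW. Qed.

(** Both integrands satisfy the same assumptions; indexing them by a boolean lets one
    proof treat them together. *)
Definition component (b : bool) (u : U) (z : Z) : R :=
  if b then g1 ghat1 u z else g2 alpha ghat2 u z.

Lemma component_lln (b : bool) :
  {ae PO, forall w, forall z, An z -> forall e : R, 0 < e ->
  exists2 r : R, 0 < r & \forall nu \near \oo, forall z', An z' -> `|z' - z| < r ->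
    `|nu%:R^-1 * \sum_(j < nu) component b (snu nu (smp j w) (T z').1) (T z') -
      \int[P]_x component b (s x (T z).1) (T z)| <= e}.
Proof.
have [An0|/set0P nAn0] := eqVneq An set0; first by apply: aeW => w z; rewrite An0.
have [D [AD Dd]] := dense_sequence nAn0.
move: growth => [eta [kappa [lam [mu [rho [pi [D0 [Dl [[eta0 kap0 lm0] [pos [[i1 i2]
  [hold [bnd loc]]]]]]]]]]]]].
have n2 : (0 : R) < n.+2%:R by [].
apply: (@approximate_solution_lln _ _ _ _ _ _ _ _ lln ae_smp Zn U Z An D T
  (fun x z => s x z.1) (fun nu x z => snu nu x z.1) (component b) AD Dd _ _ _
  eta kappa lam mu pi D0 Dl eta0 kap0 lm0 _ i1 i2 _ bnd _).
- apply: filterS s_cont => x sx z.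
  have g_cont : continuous (fun uz : U * Z => component b uz.1 uz.2) by case: (b).
  apply: (@continuous_comp _ _ _ (fun z : Zn => (s x (T z).1, T z))
    (fun uz : U * Z => component b uz.1 uz.2)); last exact: g_cont.
  apply: (@cvg_pair _ _ _ _ (nbhs (s x (T z).1)) (nbhs (T z))); last exact: T_cont.
  apply: (@continuous_comp _ _ _ T (fun z : Z => s x z.1)); first exact: T_cont.
  exact: sx.
- by move=> z Az; have [h1 h2] := G_int Az; case: (b).
- move=> z Az; have [r [c [r0 _ ic hc]]] := G_dom Az.
  exists (r / n.+2%:R), c; split => //; first exact: divr_gt0.
  move=> z' Az' /(eucl_ball_near r0) /hc /(_ Az') /ae_components_le.
  by apply: filterS => x []; case: (b).
- by move=> z /pos[_ /ltW].
- by move=> z Az u u'; have [h1 h2] := hold z Az u u'; case: (b).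
- move=> z Az; have [r0 _ _ _] := pos z Az.
  have [/le_of_ereal_sup_ltey[K hK] /le_of_ereal_sup_ltey[M hM] dcvg] := loc z Az.
  exists (rho z / n.+2%:R), K, M; split.
  + exact: divr_gt0.
  + move=> z' Az' /(eucl_ball_near r0) zz'.
    by split; [exact: hK|exact: hM].
  + move=> e e0.
    have /dcvg : nbhs (0%E : \bar R) [set x | (x < e%:E)%E].
      apply: open_nbhs_nbhs; split; last by rewrite /= lte_fin.
      exact: open_ereal_lt_ereal.
    move=> [N _ hN]; exists N => // nu /hN/= hnu z' Az' /(eucl_ball_near r0) zz'.
    rewrite -lee_fin; apply: le_trans (ltW hnu).
    by apply: ereal_sup_ubound; exists z'.
Qed.

(** Smoothing the positive part costs at most [beta * ln 2] per summand. *)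
Lemma Snu_near_average w nu z : (0 < nu)%N ->
  `|Snu alpha ghat2 That (snu nu) (fun j => smp j w) nu (beta nu) z -
    nu%:R^-1 * \sum_(j < nu) component false (snu nu (smp j w) (T z).1) (T z)| <=
  (1 - alpha)^-1 * (beta nu * ln 2).
Proof.
move=> nu0; case: z => z [gam sig]; rewrite /Snu /component /g2 /T /Tmap/=.
have nR : (0 : R) < nu%:R by rewrite ltr0n.
have a0 : 0 < 1 - alpha by rewrite subr_gt0.
have nV : 0 <= nu%:R^-1 :> R by rewrite invr_ge0.
have aV : 0 <= (1 - alpha)^-1 by rewrite invr_ge0 ltW.
rewrite -mulrBr -sumrB normrM (ger0_norm nV) ler_pdivrMl//.
apply: le_trans (ler_norm_sum _ _ _) _.
apply: (@le_trans _ _ (\sum_(j < nu) ((1 - alpha)^-1 * (beta nu * ln 2)))); last first.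
  by rewrite sumr_const card_ord mulr_natl.
apply: ler_sum => j _; rewrite opprD addrACA subrr add0r -mulrBr normrM.
rewrite (ger0_norm aV) ler_wpM2l//.
exact: smax_near_max (beta0 nu0).
Qed.

Lemma sample_convergence :
  {ae PO, forall w, forall z, An z -> forall e : R, 0 < e ->
  exists2 r : R, 0 < r & \forall nu \near \oo, forall z', An z' -> `|z' - z| < r ->
    `|nu%:R^-1 * \sum_(j < nu) ghat1 (snu nu (smp j w) (That z'.1)) (That z'.1) -
      mean P (fun x => ghat1 (s x (T z).1) (T z).1)| <= e /\
    `|Snu alpha ghat2 That (snu nu) (fun j => smp j w) nu (beta nu) z' -
      psi alpha ghat2 P s (T z)| <= e}.
Proof.
apply: filterS2 (component_lln true) (component_lln false) => w h1 h2 z Az e e0.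
have e2 : 0 < e / 2 by rewrite divr_gt0.
have [r1 r10 c1] := h1 z Az e e0; have [r2 r20 c2] := h2 z Az _ e2.
exists (Num.min r1 r2); first by rewrite lt_min r10.
have b0 : \forall nu \near \oo, (1 - alpha)^-1 * (beta nu * ln 2) <= e / 2 /\ (0 < nu)%N.
  have : (fun nu => (1 - alpha)^-1 * (beta nu * ln 2)) @ \oo --> (1 - alpha)^-1 * (0 * ln 2).
    apply: cvgMr; exact: cvgMl.
  rewrite mul0r mulr0 => /cvgrPdist_le /(_ _ e2) bc.
  apply: filterS2 bc (nbhs_infty_gt 0%N) => nu; rewrite sub0r normrN => h nu0; split=> //.
  exact: le_trans (ler_norm _) h.
apply: filterS3 c1 c2 b0 => nu k1 k2 [k3 nu0] z' Az'; rewrite lt_min => /andP[zz1 zz2].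
rewrite /psi !meanE; split; first exact: k1.
have := le_trans (Snu_near_average w z' nu0) k3; have := k2 z' Az' zz2.
rewrite /component !ler_norml => /andP[? ?] /andP[? ?]; apply/andP; split; lra.
Qed.

End sample_convergence.

(** * Values of the actual and of the discretized problems *)

Section problem_values.
Context (R : realType) dS (S : measurableType dS) (P : probability S R).
Context (Zhat U : completeNormedModType R).
Context (alpha : R) (Ahat : set Zhat) (fhat : Zhat -> R) (ghat1 ghat2 : U -> Zhat -> R).
Context (s : S -> Zhat -> U).

Let Z : normedModType R := (Zhat * (R * R))%type.
Let A : set Z := feas Ahat.
Let f : Z -> R := obj fhat.
Let G : S -> Z -> R * R := Gmap alpha ghat1 ghat2 s.
Let psiZ : Z -> R := psi alpha ghat2 P s.
Let phiZ : Z -> \bar R := phi alpha Ahat fhat ghat1 ghat2 P s.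
Let m (z : Z) : R := mean P (fun x => ghat1 (s x z.1) z.1).

Lemma phi_feasible z : A z -> psiZ z = 0 -> phiZ z = (f z + m z)%:E.
Proof.
move=> Az pz; rewrite /phiZ /phi /hfun /iota_set.
case: asboolP => // _; case: asboolP => [_|]; last by case.
by rewrite add0e adde0.
Qed.

Lemma phi_lt_pinfty z : (phiZ z < +oo)%E -> A z /\ psiZ z = 0.
Proof.
rewrite /phiZ /phi /hfun /iota_set; case: asboolP => [Az|_]; last first.
  by case: asboolP.
by case: asboolP.
Qed.

Hypothesis alpha01 : 0 < alpha < 1.
Hypothesis g2_int : forall zhat, Ahat zhat ->
    P.-integrable setT (fun x => (ghat2 (s x zhat) zhat)%:E).

Lemma psi_shortfall z : A z -> psiZ z = z.2.2 + z.2.1 +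
  (1 - alpha)^-1 * shortfall P (fun x => ghat2 (s x z.1) z.1) z.2.1.
Proof.
move=> [/g2_int ig _]; have ie := integrable_excess ig z.2.1.
rewrite /psiZ /psi meanE /g2 RintegralD//; last 2 first.
- exact: (integrable_const P).
- exact: integrable_scale.
by rewrite (Rintegral_const P) RintegralZl.
Qed.

Lemma bprob_of_psi0 z : A z -> psiZ z = 0 ->
  bprob P (fun x => ghat2 (s x z.1) z.1) <= 1 - alpha.
Proof.
move=> Az pz; have [Az1 s0] := Az.
apply/(bprob_leP (g2_int Az1) alpha01); exists z.2.1.
by move: pz; rewrite psi_shortfall//; lra.
Qed.

(** The slack [sigma] absorbs the gap in the inequality given by [bprob_leP]. *)
Lemma psi0_of_bprob zhat : bp_feas alpha Ahat ghat2 P s zhat ->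
  exists gs : R * R, A (zhat, gs) /\ psiZ (zhat, gs) = 0.
Proof.
move=> [Az /(bprob_leP (g2_int Az) alpha01)[g hg]].
exists (g, - (g + (1 - alpha)^-1 * shortfall P (fun x => ghat2 (s x zhat) zhat) g)).
have Azg : A (zhat, (g, - (g + (1 - alpha)^-1 *
    shortfall P (fun x => ghat2 (s x zhat) zhat) g))).
  by split => //=; rewrite oppr_ge0.
by split => //; rewrite psi_shortfall//=; lra.
Qed.

Variable tau : R.
Hypothesis inf_phi : inf_of phiZ = tau%:E.

Lemma tau_le z : A z -> psiZ z = 0 -> tau <= f z + m z.
Proof.
move=> Az pz; rewrite -lee_fin -inf_phi -phi_feasible//.
by apply: ereal_inf_lbound; exists z.
Qed.

(** The reformulation with [gamma] and [sigma] covers every point that is feasible for the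
    constraint on the buffered probability, at the same cost. *)
Lemma tau_le_bp_value : (tau%:E <= bp_value alpha Ahat fhat ghat1 ghat2 P s)%E.
Proof.
apply: le_ereal_inf_tmp => _ [zhat /psi0_of_bprob[gs [Az pz]] <-].
by rewrite lee_fin; exact: (tau_le Az pz).
Qed.

Lemma near_minimizer (e : R) : 0 < e ->
  exists z, [/\ A z, psiZ z = 0 & f z + m z <= tau + e].
Proof.
move=> e0; have : inf_of phiZ \is a fin_num by rewrite inf_phi.
move=> /(lb_ereal_inf_adherent e0)[_ [z _ <-]].
rewrite -/(inf_of phiZ) inf_phi => lt.
have [Az pz] : A z /\ psiZ z = 0.
  by apply: phi_lt_pinfty; apply: lt_trans lt _; rewrite ltry.
by exists z; split => //; move: lt; rewrite phi_feasible// lte_fin => /ltW.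
Qed.

Hypothesis f_cont : {within A, continuous f}.
Hypothesis s_cont : {ae P, forall x, continuous (fun z : Z => s x z.1)}.
Hypothesis g1_cont : continuous (fun uz : U * Z => g1 ghat1 uz.1 uz.2).
Hypothesis G_int : forall z, A z -> P.-integrable setT (fun x => (G x z).1%:E) /\
                    P.-integrable setT (fun x => (G x z).2%:E).
Hypothesis G_dom : forall zbar, A zbar -> exists (rho : R) (c : S -> R),
      [/\ 0 < rho, P.-integrable setT (fun x => (c x)%:E)
        & forall z, A z -> `|z - zbar| <= rho ->
            {ae P, forall x, `|G x z| <= c x}].

Lemma obj_cvg z (zs : nat -> Z) : A z -> (forall k, A (zs k)) -> zs @ \oo --> z ->
  (fun k => f (zs k)) @ \oo --> f z.
Proof.
move=> Az Azs zsz.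
have /subspace_continuousP := f_cont; move=> /(_ z Az).
move=> h B /h hB; have := zsz _ hB; move=> [N _ hN]; exists N => // k /hN; apply.
exact: Azs.
Qed.

Lemma mean_cvg z (zs : nat -> Z) : A z -> (forall k, A (zs k)) -> zs @ \oo --> z ->
  (fun k => m (zs k)) @ \oo --> m z.
Proof.
move=> Az Azs zsz; have [rho [c [rho0 ic hc]]] := G_dom Az.
have : \forall k \near \oo, `|zs k - z| <= rho.
  have /cvgrPdist_le /(_ _ rho0) := zsz.
  by apply: filterS => k; rewrite distrC.
move=> [N _ hN]; rewrite -(cvg_shiftn N) /=.
have mE z' : m z' = \int[P]_x (G x z').1 by rewrite /m meanE.
under eq_fun do rewrite mE.
rewrite mE.
apply: (@Rintegral_dominated_cvg _ _ _ P (fun k x => (G x (zs (k + N)%N)).1)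
  (fun x => (G x z).1) c).
- by move=> k; exact: integrable_measurable (G_int (Azs _)).1.
- exact: integrable_measurable (G_int Az).1.
- exact: ic.
- apply: filterS s_cont => x sx.
  have zsz' : (fun k => zs (k + N)%N) @ \oo --> z by rewrite cvg_shiftn.
  have sc : (fun k => s x (zs (k + N)%N).1) @ \oo --> s x z.1.
    exact: (cvg_comp _ _ zsz' (sx z)).
  have pc : (fun k => (s x (zs (k + N)%N).1, zs (k + N)%N)) @ \oo --> (s x z.1, z).
    exact: cvg_pair sc zsz'.
  exact: (cvg_comp _ _ pc (@g1_cont (s x z.1, z))).
- apply: ae_foralln => k.
  have h : `|zs (k + N)%N - z| <= rho by apply: hN; rewrite /= leq_addl.
  by apply: filterS (ae_components_le (hc _ (Azs _) h)) => x [].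
Qed.

Context (Zhatn : nat -> set Zhat) (That : forall n : nat, 'rV[R]_n -> Zhat).
Hypothesis That_range : forall n, (0 < n)%N -> range (@That n) = Zhatn n.
Hypothesis qualification : forall z, A z -> psiZ z = 0 ->
    exists zs : nat -> Z,
      [/\ (forall n, (0 < n)%N -> A (zs n) /\ Zhatn n (zs n).1),
          zs @ \oo --> z
        & forall n, (0 < n)%N -> psiZ (zs n) < 0].

Lemma psi_add z (t : R) : A z -> 0 <= t ->
  A (z.1, (z.2.1, z.2.2 + t)) /\ psiZ (z.1, (z.2.1, z.2.2 + t)) = psiZ z + t.
Proof.
move=> [Az s0] t0; have Az' : A (z.1, (z.2.1, z.2.2 + t)).
  by split => //=; rewrite addr_ge0.
by split => //; rewrite !psi_shortfall//=; ring.
Qed.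

(** A near-minimizer is approximated by discretized points with [psi < 0], which are
    brought back to [psi = 0] by raising [sigma]. As the cost does not
    involve [sigma], it only has to converge along the sequence. *)
Lemma discretized_near_minimizer (e : R) : 0 < e ->
  exists N, forall n, (N <= n)%N -> (0 < n)%N ->
    exists zn, [/\ feas_n Ahat (@That n) zn, psiZ (Tmap (@That n) zn) = 0 &
      f (Tmap (@That n) zn) + m (Tmap (@That n) zn) <= tau + e].
Proof.
move=> e0; have e3 : 0 < e / 3 by rewrite divr_gt0.
have [z [Az pz hz]] := near_minimizer e3.
have [zs [hzs zsz pzs]] := qualification Az pz.
pose zs' k := zs k.+1.
have zs'z : zs' @ \oo --> z by rewrite (cvg_shiftS zs).
have Azs' k : A (zs' k) by have [] := hzs k.+1 isT.
have /cvgrPdist_le /(_ _ e3) c1 := obj_cvg Az Azs' zs'z.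
have /cvgrPdist_le /(_ _ e3) c2 := mean_cvg Az Azs' zs'z.
have [N _ hN] : \forall k \near \oo, `|f z - f (zs' k)| <= e / 3 /\
    `|m z - m (zs' k)| <= e / 3 by apply: filterS2 c1 c2.
exists N.+1 => -[//|n]; rewrite ltnS => /hN[/=]; rewrite /zs' => b1 b2 _.
have [Azn rn] := hzs n.+1 isT.
move: (rn); rewrite -That_range// => -[v _ vE].
(* Raising [sigma] by [- psi] restores the equality constraint. *)
have t0 : 0 <= - psiZ (zs n.+1) by rewrite oppr_ge0 ltW// pzs.
have [Az' pz'] := psi_add Azn t0.
exists (v, ((zs n.+1).2.1, (zs n.+1).2.2 - psiZ (zs n.+1))).
rewrite /feas_n /Tmap/= vE; split => //.
  by rewrite pz' subrr.
change (f (zs n.+1) + m (zs n.+1) <= tau + e).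
by move: b1 b2; rewrite !ler_norml => /andP[? ?] /andP[? ?]; lra.
Qed.

End problem_values.

(** * Feasibility and optimality of cluster points *)

(** The slack enters every summand additively. *)
Lemma Snu_lift (R : realType) (Zhat U : completeNormedModType R) (alpha : R)
    (ghat2 : U -> Zhat -> R) n (That : 'rV[R]_n -> Zhat) (S : Type)
    (snu : S -> Zhat -> U) (smp : nat -> S) (nu : nat) (beta : R)
    (zn : 'rV[R]_n * (R * R)) (t : R) : (0 < nu)%N ->
  Snu alpha ghat2 That snu smp nu beta (zn.1, (zn.2.1, zn.2.2 + t)) =
  Snu alpha ghat2 That snu smp nu beta zn + t.
Proof.
move=> nu0; case: zn => z [gam sig]; rewrite /Snu /Tmap/=.
have nR : nu%:R != 0 :> R by rewrite pnatr_eq0 -lt0n.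
rewrite (eq_bigr (fun j : 'I_nu => t + (sig + gam +
  (1 - alpha)^-1 * smax (ghat2 (snu (smp j) (That z)) (That z) - gam) beta))); last first.
  by move=> j _; ring.
by rewrite big_split/= sumr_const card_ord mulrDr -[t *+ nu]mulr_natl mulKf// addrC.
Qed.

Lemma within_continuous_comp (R : realType) (V W : normedModType R) (A : set W)
    (f : W -> R) (T : V -> W) (z : V) (e : R) :
  {within A, continuous f} -> continuous T -> A (T z) -> 0 < e ->
  exists2 r : R, 0 < r & forall z', A (T z') -> `|z' - z| < r ->
    `|f (T z') - f (T z)| <= e.
Proof.
move=> /subspace_continuousP fc Tc Az e0.
have hf : nbhs (T z) (fun x => A x -> `|f (T z) - f x| <= e).
  by have /cvgrPdist_le /(_ _ e0) := fc _ Az.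
have /nbhs_ballP[r /= r0 hr] := Tc z _ hf.
exists r => // z' Az' zz'; rewrite distrC; apply: hr => //.
by rewrite -ball_normE/= distrC.
Qed.

Theorem proposition4p13
  (R : realType)
  (Zhat U Xi : completeNormedModType R)
  (d : measure_display) (Om : measurableType d) (PO : probability Om R)
  (xi : {mfun Om >-> borel_type Xi})
  (smp : nat -> {mfun Om >-> borel_type Xi})
  (alpha : R) (Ahat : set Zhat) (fhat : Zhat -> R)
  (ghat1 ghat2 : U -> Zhat -> R)
  (s : Xi -> Zhat -> U) (snu : nat -> Xi -> Zhat -> U)
  (Zhatn : nat -> set Zhat) (That : forall n : nat, 'rV[R]_n -> Zhat)
  (y theta beta : nat -> R) (tau : R) (nbar : nat) :
  let Z : normedModType R := (Zhat * (R * R))%type in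
  let Zn (n : nat) := ('rV[R]_n * (R * R))%type in
  let P : probability (law_type PO xi) R := law PO xi in
  let A : set Z := feas Ahat in
  let f : Z -> R := obj fhat in
  let G : law_type PO xi -> Z -> R * R := Gmap alpha ghat1 ghat2 s in
  let psiZ : Z -> R := psi alpha ghat2 P s in
  let T (n : nat) : Zn n -> Z := Tmap (That n) in
  let An (n : nat) : set (Zn n) := feas_n Ahat (That n) in
  let phiZ : Z -> \bar R := phi alpha Ahat fhat ghat1 ghat2 P s in
  let phin (n : nat) : Zn n -> \bar R := fun zn => phiZ (T n zn) in
  let phinu (w : Om) (n nu : nat) : Zn n -> \bar R :=
    phi_nu alpha Ahat fhat ghat1 ghat2 (That n) (snu nu) (fun j => smp j w)
      nu (y nu) (theta nu) (beta nu) in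
  (* standing assumptions *)
  separable Zhat -> separable U -> hilbert_norm Xi ->
  0 < alpha < 1 ->
  (forall zhat, Ahat zhat ->
    P.-integrable setT (fun x => (ghat2 (s x zhat) zhat)%:E)) ->
  (forall z, A z -> P.-integrable setT (fun x => (G x z).1%:E) /\
                    P.-integrable setT (fun x => (G x z).2%:E)) ->
  (forall n, (0 < n)%N -> range (That n) = Zhatn n) ->
  (0 < nbar)%N ->
  (* assumptions on the actual problem *)
  inf_of phiZ = tau%:E ->
  closed A ->
  {within A, continuous f} ->
  independent_seq PO smp ->
  (forall j, same_law PO (smp j) xi) ->
  (* (B_Z) *)
  (forall zbar, A zbar ->
    measurable_fun setT (fun x => G x zbar) /\
    exists (rho : R) (c : law_type PO xi -> R),
      [/\ 0 < rho, (forall x, 0 <= c x),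
          P.-integrable setT (fun x => (c x)%:E)
        & forall z, A z -> `|z - zbar| <= rho ->
            {ae P, forall x, `|G x z| <= c x}]) ->
  (* (Q) *)
  (forall z, A z -> psiZ z = 0 ->
    exists zs : nat -> Z,
      [/\ (forall n, (0 < n)%N -> A (zs n) /\ Zhatn n (zs n).1),
          zs @ \oo --> z
        & forall n, (0 < n)%N -> psiZ (zs n) < 0]) ->
  (forall n, (nbar <= n)%N ->
    (inf_of (@phin n) < +oo)%E /\
    (* 1 *)
    [/\ {ae P, forall x, continuous (fun z : Z => s x z.1)},
        continuous (fun uz : U * Z => g1 ghat1 uz.1 uz.2),
        continuous (fun uz : U * Z => g2 alpha ghat2 uz.1 uz.2),
        continuous (T n)
      & forall zn, measurable_fun setT (fun x => G x (T n zn))] /\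
    (* 2 *)
    (forall zbar, An n zbar ->
      exists (rho : R) (c : law_type PO xi -> R),
        [/\ 0 < rho, (forall x, 0 <= c x),
            P.-integrable setT (fun x => (c x)%:E)
          & forall zn, eucl_ball zbar rho zn -> An n zn ->
              {ae P, forall x, `|G x (T n zn)| <= c x}]) /\
    (* 3 *)
    (exists (eta kappa : R) (lambda mu : law_type PO xi -> R)
            (rho pi Delta0 : Zn n -> R) (Delta : nat -> Zn n -> R),
      [/\ 0 < eta, 0 < kappa &
          forall x, 0 <= lambda x /\ 0 <= mu x] /\
      (forall zn, An n zn ->
        [/\ 0 < rho zn, 0 < pi zn, 0 <= Delta0 zn
          & forall nu, (0 < nu)%N -> 0 <= Delta nu zn]) /\
      (* (i) *)
      (P.-integrable setT (fun x => (lambda x `^ eta * mu x `^ kappa)%:E) /\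
       P.-integrable setT (fun x => (mu x `^ kappa)%:E)) /\
      (* (ii) *)
      (forall zn, An n zn -> forall u u' : U,
        `|g1 ghat1 u (T n zn) - g1 ghat1 u' (T n zn)| <=
          pi zn * (`|u| `^ eta + `|u'| `^ eta + 1) * `|u - u'| `^ kappa /\
        `|g2 alpha ghat2 u (T n zn) - g2 alpha ghat2 u' (T n zn)| <=
          pi zn * (`|u| `^ eta + `|u'| `^ eta + 1) * `|u - u'| `^ kappa) /\
      {ae P, forall x, forall zn, An n zn -> forall nu, (0 < nu)%N ->
        Num.max `|s x (T n zn).1| `|snu nu x (T n zn).1|
          <= lambda x * Delta0 zn /\
        `|snu nu x (T n zn).1 - s x (T n zn).1| <= mu x * Delta nu zn} /\
      (* (iii) *)
      (forall zbar, An n zbar ->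
        let B := eucl_ball zbar (rho zbar) `&` An n in
        [/\ (ereal_sup [set (pi zn)%:E | zn in B] < +oo)%E,
            (ereal_sup [set (Delta0 zn)%:E | zn in B] < +oo)%E
          & (fun nu => ereal_sup [set (Delta nu zn)%:E | zn in B]) @ \oo
              --> 0%E])) /\
    (* 4 *)
    (forall zn, An n zn -> psiZ (T n zn) = 0 ->
      exists zs : nat -> Zn n,
        [/\ (forall nu, (0 < nu)%N -> An n (zs nu)),
            zs @ \oo --> zn
          & forall nu, (0 < nu)%N -> psiZ (T n (zs nu)) < 0])) ->
  (* parameters of the approximation *)
  (exists M : R, forall nu, (0 < nu)%N -> `|y nu| <= M) ->
  (forall nu, (0 < nu)%N -> 0 < theta nu) ->
  theta @ \oo --> +oo ->
  (forall nu, (0 < nu)%N -> 0 < beta nu) ->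
  beta @ \oo --> 0 ->
  {ae PO, forall w, forall eps : R, 0 < eps ->
    exists neps : nat, (nbar <= neps)%N /\
    forall n, (neps <= n)%N ->
    forall (deltas : nat -> R) (delta : R),
      (forall nu, (0 < nu)%N -> 0 <= deltas nu) -> 0 <= delta ->
      deltas @ \oo --> delta ->
    forall (zs : nat -> Zn n) (zbarn : Zn n),
      (forall nu, (0 < nu)%N -> delta_argmin (deltas nu) (@phinu w n nu) (zs nu)) ->
      cluster (zs @ \oo) zbarn ->
      let zbar := T n zbarn in
      [/\ A zbar,
          f zbar + mean P (fun x => ghat1 (s x zbar.1) zbar.1)
            <= tau + eps + delta,
          bprob P (fun x => ghat2 (s x zbar.1) zbar.1) <= 1 - alpha,
          bp_feas alpha Ahat ghat2 P s zbar.1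
        & ((bp_cost fhat ghat1 P s zbar.1)%:E <=
            bp_value alpha Ahat fhat ghat1 ghat2 P s + (eps + delta)%:E)%E]}.
Proof.
move=> Z Zn P A f G psiZ T An phiZ phin phinu _ _ _ al01 g2i Gi Tr nb0 infphi
  Acl fc ind same BZ Q Hn yb th0 thoo be0 beo.
have [al0 al1] := andP al01.
have lln (h : law_type PO xi -> R) (c : R) : P.-integrable setT (EFin \o h) ->
    \int[P]_x h x < c ->
    {ae PO, forall w, \forall n \near \oo,
      n%:R^-1 * \sum_(j < n) h (smp j w) <= c}.
  exact: (sample_average_upper ind same).
have aesmp (C : law_type PO xi -> Prop) : {ae P, forall x, C x} ->
    {ae PO, forall w, forall j, C (smp j w)}.
  exact: (ae_sample same).
have conv n : (nbar <= n)%N -> {ae PO, forall w, forall z, An n z -> forall e : R, 0 < e ->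
  exists2 r : R, 0 < r & \forall nu \near \oo, forall z', An n z' -> `|z' - z| < r ->
    `|nu%:R^-1 * \sum_(j < nu) ghat1 (snu nu (smp j w) (That n z'.1)) (That n z'.1) -
      mean P (fun x => ghat1 (s x (T n z).1) (T n z).1)| <= e /\
    `|Snu alpha ghat2 (That n) (snu nu) (fun j => smp j w) nu (beta nu) z' -
      psiZ (T n z)| <= e}.
  move=> nn; have [_ [[sc g1c g2c Tc _] [dom [growth _]]]] := Hn n nn.
  exact: (sample_convergence lln aesmp al1 Gi sc g1c g2c Tc dom growth be0 beo).
have {}conv : {ae PO, forall w, forall n, (nbar <= n)%N ->
  forall z, An n z -> forall e : R, 0 < e ->
  exists2 r : R, 0 < r & \forall nu \near \oo, forall z', An n z' -> `|z' - z| < r ->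
    `|nu%:R^-1 * \sum_(j < nu) ghat1 (snu nu (smp j w) (That n z'.1)) (That n z'.1) -
      mean P (fun x => ghat1 (s x (T n z).1) (T n z).1)| <= e /\
    `|Snu alpha ghat2 (That n) (snu nu) (fun j => smp j w) nu (beta nu) z' -
      psiZ (T n z)| <= e}.
  apply: ae_foralln => n; have [nn|nn] := boolP (nbar <= n)%N; last exact: aeW.
  by apply: filterS (conv n nn) => w.
have [_ [[sc g1c _ _ _] _]] := Hn nbar (leqnn nbar).
have Gdom zbar : A zbar -> exists (rho : R) (c : law_type PO xi -> R),
      [/\ 0 < rho, P.-integrable setT (fun x => (c x)%:E)
        & forall z, A z -> `|z - zbar| <= rho ->
            {ae P, forall x, `|G x z| <= c x}].
  by move=> /BZ[_ [rho [c [? _ ? ?]]]]; exists rho, c.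
apply: filterS conv => w conv eps eps0.
have [N hN] := discretized_near_minimizer g2i infphi fc sc g1c Gi Gdom Tr Q eps0.
exists (maxn nbar N); split; first exact: leq_maxl.
move=> n; rewrite geq_max => /andP[nn Nn] deltas delta _ _ dcvg zs zbarn zsm zscl.
pose zbar := T n zbarn.
have n0 : (0 < n)%N by exact: leq_trans nn.
have [zn [Azn pzn vzn]] := hN n Nn n0.
have [_ [[_ _ _ Tc _] [_ [_ qual]]]] := Hn n nn.
have [|||||Ab pb vb] := @cluster_optimal R (Zn n) (An n) (fun z => fhat (That n z.1))
  (fun z => mean P (fun x => ghat1 (s x (T n z).1) (T n z).1)) (fun z => psiZ (T n z))
  (fun nu z => nu%:R^-1 * \sum_(j < nu) ghat1 (snu nu (smp j w) (That n z.1)) (That n z.1))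
  (fun nu => Snu alpha ghat2 (That n) (snu nu) (fun j => smp j w) nu (beta nu))
  y theta (fun z t => (z.1, (z.2.1, z.2.2 + t))) _ _ (conv n nn)
  _ _ (fun _ _ => erefl) (fun _ _ _ => erefl) _ yb th0 thoo
  deltas delta zs zbarn dcvg zsm zscl (ex_intro _ zn (conj Azn pzn)).
- exact: (proj1 (continuous_closedP _) Tc).
- move=> z Az e e0; have [r r0 hr] := within_continuous_comp fc Tc Az e0.
  by exists r.
- move=> z Az pz r r0; have [zs' [Azs' zsz' pzs']] := qual z Az pz.
  have /cvgrPdist_lt /(_ _ r0) [K _ hK] := zsz'.
  exists (zs' K.+1); split; [exact: Azs'| |exact: pzs'].
  by rewrite distrC; apply: hK => /=.
- by move=> z t [Az1 Az2] t0; split => //=; rewrite addr_ge0.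
- by move=> nu z t nu0; exact: Snu_lift.
have vbar : f zbar + mean P (fun x => ghat1 (s x zbar.1) zbar.1) <= tau + eps + delta.
  by apply: le_trans (vb zn Azn pzn) _; rewrite lerD2r.
have bb : bprob P (fun x => ghat2 (s x zbar.1) zbar.1) <= 1 - alpha.
  exact: (bprob_of_psi0 al01 g2i Ab pb).
have tb := tau_le_bp_value al01 g2i infphi.
split=> //; first by split=> //; have [] := Ab.
apply: le_trans (_ : (tau%:E + (eps + delta)%:E <= _)%E); last by rewrite leeD2r.
by rewrite -EFinD lee_fin addrA.
Qed.
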